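(* Let $X_t,Y_t\ge0$ be $\mathcal F_t$-adapted stochastic processes satisfying $$dX_t\le-Y_t\,dt+\mathcal C_t(1+t)^\kappa X_t^\alpha\,dt+\mathcal C_t(1+t)^{-\beta}\,dt+dM_t,\qquad\int_0^tX_s\,ds\le\mathcal C_t(1+t)^p+\mathcal C_t,$$ where $\alpha>1$, $p\ge0$, $\kappa,\beta\in\mathbb R$, $M_t$ is an $\mathcal F_t$-adapted continuous local martingale and $\mathcal C_t=\mathcal C_t(\omega)$ is a positive increasing $\mathcal F_t$-adapted stochastic process. Assume moreover: (1) there exist $\zeta\in\mathbb R$ and $\theta\in(0,1)$ such that $X_t\le\mathcal C_t^\theta(1+t)^{\zeta\theta}Y_t^{1-\theta}$; (2) there exist $\xi_j\in\mathbb R$, $\theta_j'\in[0,1]$ and $\gamma_j>0$, $j=1,\dots,\mathfrak n$, and a constant $C$ such that $$\frac{d}{dt}\langle M\rangle_t\le C\sum_{j=1}^{\mathfrak n}(1+t)^{\xi_j}X_t^{\gamma_j\theta_j'}Y_t^{1-\theta_j'}.$$ For $\theta_j'>0$ set $\psi_j:=\gamma_j-1/\theta_j'-1$; set $\xi:=\max\{\xi_j:\theta_j'=0\}$ and $$\bar\rho:=(1-p)\wedge\Big(\beta\wedge\big(\tfrac1\theta-\zeta\big)-1\Big)\wedge(-\xi)\wedge\min\Big\{\frac{\theta_j'+\xi_j}{\theta_j'\psi_j}:\theta_j'>0\text{ and }\psi_j<0\Big\}.$$ Assume that (A1) $\xi_j<\theta_j'(\bar\rho\,\psi_j-1)$ whenever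 $\theta_j'>0$ and $\psi_j\ge0$, $j=1,\dots,\mathfrak n$; (A2) $\kappa<(\alpha-1)\bar\rho-1$; (A3) $\displaystyle\lim_{R\to+\infty}\mathbb P\Big(\lim_{t\to+\infty}\mathcal C_t(\omega)>R\Big)=0$. Then for any $\rho<\bar\rho$, almost surely, $X_t=O(t^{-\rho})$ as $t\to\infty$.
   Context: The processes live on a filtered probability space $(\Omega,\mathcal F,\{\mathcal F_t\}_{t\ge0},\mathbb P)$. The differential inequality is understood as the corresponding inequality for increments obtained by integrating over time intervals. $\langle M\rangle$ is the quadratic variation. Conventions: $a\wedge b=\min\{a,b\}$ and $\min\emptyset=+\infty$ (and correspondingly the term $-\xi$ is $+\infty$ if no $\theta_j'$ vanishes). *)

(* Defs.v *)
From HB Require Import structures.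
From mathcomp Require Import all_boot all_order all_algebra.
From mathcomp Require Import all_classical all_reals all_analysis.
Set Implicit Arguments.
Unset Strict Implicit.
Unset Printing Implicit Defensive.
Import Order.TTheory GRing.Theory Num.Theory.
Import numFieldNormedType.Exports.
Local Open Scope classical_set_scope.
Local Open Scope ring_scope.

(* Processes and filtrations are indexed by all of [R]; only their values at
   times [0 <= t] are ever constrained or used. *)

(* Needed for Landau notations at [+oo]. *)
Canonical pinfty_filter_on (R : numFieldType) :=
  FilterType (pinfty_nbhs R) (@filter_filter R _ proper_pinfty_nbhs).

Section processes.
Context {R : realType} {d : measure_display} {T : measurableType d}.
Implicit Types (F : R -> set (set T)) (Z M A : R -> T -> R) (tau : T -> \bar R).

Definition filtration F : Prop :=
  (forall t, 0 <= t -> sigma_algebra setT (F t)) /\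
  (forall t, 0 <= t -> F t `<=` measurable) /\
  (forall s t, 0 <= s -> s <= t -> F s `<=` F t).

Definition adapted F Z : Prop :=
  forall t, 0 <= t -> forall B : set R, measurable B -> F t (Z t @^-1` B).

Definition continuous_process Z : Prop :=
  forall w, {within `[0, +oo[, continuous (fun t => Z t w)}.

Definition nondecreasing_process Z : Prop :=
  forall w s t, 0 <= s -> s <= t -> Z s w <= Z t w.

Definition stopping_time F tau : Prop :=
  (forall w, (0 <= tau w)%E) /\
  (forall t, 0 <= t -> F t [set w | (tau w <= t%:E)%E]).

(* For [0 <= t] and [0 <= tau w], [mine t%:E (tau w)] is finite. *)
Definition stopped Z tau : R -> T -> R :=
  fun t w => Z (fine (mine t%:E (tau w))) w.

(* The last clause is [E[Z t | F s] = Z s]. *)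
Definition martingale F (P : probability T R) Z : Prop :=
  adapted F Z /\
  (forall t, 0 <= t -> P.-integrable setT (EFin \o Z t)) /\
  (forall s t, 0 <= s -> s <= t -> forall E, F s E ->
     (\int[P]_(w in E) (Z t w)%:E = \int[P]_(w in E) (Z s w)%:E)%E).

(* The initial value is subtracted, so it need not be integrable. *)
Definition continuous_local_martingale F (P : probability T R) M : Prop :=
  adapted F M /\ continuous_process M /\
  exists tau : nat -> T -> \bar R,
    (forall n, stopping_time F (tau n)) /\
    (forall n w, (tau n w <= tau n.+1 w)%E) /\
    {ae P, forall w, tau n w @[n --> \oo] --> +oo%E} /\
    (forall n, martingale F P (fun t w => stopped M (tau n) t w - M 0 w)).

(* [A] is the process <M>: the compensator of [M ^+ 2], unique up to
   indistinguishability. *)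
Definition quadratic_variation F (P : probability T R) M A : Prop :=
  adapted F A /\ continuous_process A /\ nondecreasing_process A /\
  (forall w, A 0 w = 0) /\
  continuous_local_martingale F P (fun t w => M t w ^+ 2 - A t w).

End processes.

Section increments.
Context {R : realType}.

(* [dx_t <= b_t dt + dm_t] on [0, +oo[, in integrated form; the drift [b] is
   locally integrable, without which the integral has no meaning. *)
Definition increments_le (x b m : R -> R) : Prop :=
  forall s t, 0 <= s -> s <= t ->
    lebesgue_measure.-integrable `[s, t] (EFin \o b) /\
    x t - x s <= \int[lebesgue_measure]_(r in `[s, t]) b r + (m t - m s).

End increments.

Section exponent.
Context {R : realType} {n : nat}.
Variables (p beta zeta theta : R) (xi theta' gamma : 'I_n -> R).

(* Meaningful only when [0 < theta' j]. *)
Definition psi (j : 'I_n) : R := gamma j - (theta' j)^-1 - 1.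

(* [-oo] when no [theta' j] vanishes. *)
Definition xi_max : \bar R :=
  \big[maxe/-oo%E]_(j < n | theta' j == 0) (xi j)%:E.

Definition rho_bar_ereal : \bar R :=
  mine (1 - p)%:E
 (mine (Num.min beta (theta^-1 - zeta) - 1)%:E
 (mine (- xi_max)%E
   (\big[mine/+oo%E]_(j < n | (0 < theta' j) && (psi j < 0))
      ((theta' j + xi j) / (theta' j * psi j))%:E))).

Definition rho_bar : R := fine rho_bar_ereal.

Lemma rho_barE : rho_bar%:E = rho_bar_ereal.
Proof.
rewrite /rho_bar fineK // /rho_bar_ereal.
have min_fin (a : R) (y : \bar R) :
    y != -oo%E -> mine a%:E y \is a fin_num /\ mine a%:E y != -oo%E.
  by case: y => [y _|_|//]; rewrite ?miney -?EFin_min.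
have min_ninfty (x y : \bar R) : x != -oo%E -> y != -oo%E -> mine x y != -oo%E.
  by move=> hx hy; rewrite /Order.min; case: ifP.
have xi_npinfty : xi_max != +oo%E.
  rewrite /xi_max; elim/big_ind: _ => // x y hx hy.
  by rewrite /Order.max; case: ifP.
have h : \big[mine/+oo%E]_(j < n | (0 < theta' j) && (psi j < 0))
      ((theta' j + xi j) / (theta' j * psi j))%:E != -oo%E.
  by elim/big_ind: _ => // x y; exact: min_ninfty.
apply: (min_fin _ _ _).1; apply: (min_fin _ _ _).2; apply: min_ninfty => //.
by move: xi_npinfty; case: xi_max.
Qed.

End exponent.

(* Main.v *)
Require Import Defs.
From HB Require Import structures.
From mathcomp Require Import all_boot all_order all_algebra.
From mathcomp Require Import all_classical all_reals all_analysis.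
From mathcomp Require Import measurable_realfun.
From mathcomp Require Import ring lra.
Set Implicit Arguments.
Unset Strict Implicit.
Unset Printing Implicit Defensive.
Import Order.TTheory GRing.Theory Num.Theory.
Import numFieldNormedType.Exports.
Local Open Scope classical_set_scope.
Local Open Scope ring_scope.

(** The decay is obtained window by window. Fix [a] slightly below [rho_bar] and
    consider the paths for which the random constants stay below some [r]; as
    almost every path is of this kind for some [r], this is no restriction.
    With [T = 2 ^ k], it suffices that for all large [k] the process stays below
    [L = T `^ (- a)] on [2 T, 4 T].

    The bound on the time integral makes the average of [X] over [T, 2 T] of
    order [T `^ (p - 1)], which is much smaller than [L] since [a < 1 - p];
    hence at some deterministic time [s] in this interval [X] is below [L / 8]
    except with probability [O(T `^ (- eps))]
    ([exists_time_crossing_prob_le]). Starting from [s], and as long as [X] stays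
    below [L], the superlinear term and the source term contribute at most
    [L / 8] over the whole window, because [kappa < (alpha - 1) a - 1] and
    [a < beta - 1]. So the height [L] can only be reached if the martingale
    moves by [L / 8]. Before that, the time integral of [Y] is at most of order
    [L], and interpolating [X `^ (gamma theta') Y `^ (1 - theta')] between the
    bounds on [X] and on this integral shows that the quadratic variation has
    grown by at most [O(T `^ (- 2 a - eps))]: this is where the definition of
    [rho_bar] and the condition on the [xi j] enter
    ([window_exit]).

    A continuous local martingale moves by [L / 8] while its quadratic variation
    grows by at most [b] with probability [O(b / L ^ 2)], here
    [O(T `^ (- eps))]. This maximal inequality
    ([local_martingale_maximal_inequality]) follows from optional stopping of
    [M] and of [M ^ 2 - <M>] at the first exit time, which is proved by rounding
    the exit time to finer and finer grids and truncating
    ([martingale_optional_stopping], [local_martingale_optional_stopping]).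
    The probabilities being summable along [T = 2 ^ k], the Borel-Cantelli lemma
    concludes. *)

(** * Optional stopping for continuous martingales *)

Lemma within_continuousP {R : realType} (D : set R) (z : R -> R) :
  {within D, continuous z} <->
  forall t, D t -> forall e, 0 < e -> exists2 del : R, 0 < del &
    forall r, D r -> `|t - r| < del -> `|z t - z r| < e.
Proof.
split=> [/subspace_continuousP cz t Dt e e0|cz].
  move/cvgrPdist_lt : (cz _ Dt) => /(_ e e0) /=; rewrite near_withinE.
  by move=> /nbhs_ballP[del /= del0 dd]; exists del => // r Dr tr; exact: dd.
apply/subspace_continuousP => t Dt.
apply/cvgrPdist_lt => e e0; rewrite near_withinE.
have [del del0 dd] := cz t Dt e e0.
by apply/nbhs_ballP; exists del => //= r tr Dr; exact: dd.
Qed.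

Lemma within_continuous_itvcyP {R : realType} (z : R -> R) :
  {within `[0, +oo[, continuous z} <->
  forall t, 0 <= t -> forall e, 0 < e -> exists2 del, 0 < del &
    forall r, 0 <= r -> `|t - r| < del -> `|z t - z r| < e.
Proof.
have itvE (t : R) : [set` `[0, +oo[] t = (0 <= t) :> Prop.
  by rewrite /= in_itv/= andbT.
split=> [/within_continuousP cz t t0 e e0|cz].
  have [|del del0 dd] := cz t _ e e0; first by rewrite itvE.
  by exists del => // r r0; apply: dd; rewrite itvE.
apply/within_continuousP => t; rewrite itvE => t0 e e0.
have [del del0 dd] := cz t t0 e e0.
by exists del => // r; rewrite itvE; exact: dd.
Qed.

Lemma within_continuous_cvg {R : realType} (z : R -> R) (r_ : nat -> R) (t : R) :
  {within `[0, +oo[, continuous z} -> 0 <= t -> (forall m, 0 <= r_ m) ->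
  r_ @ \oo --> t -> z (r_ m) @[m --> \oo] --> z t.
Proof.
move=> /within_continuous_itvcyP cz t0 r0 rt.
apply/cvgrPdist_lt => e e0; have [del del0 dd] := cz t t0 e e0.
move/cvgrPdist_lt : rt => /(_ del del0); apply: filterS => m; exact: dd.
Qed.

Section optional_stopping.
Context {R : realType} {d : measure_display} {T : measurableType d}.
Variables (P : probability T R) (F : R -> set (set T)).
Hypothesis F_filt : filtration F.
Implicit Types (Z M A : R -> T -> R) (eta : T -> R) (E H : set T).

Lemma filtration_measurableE t : 0 <= t ->
  (F t).-sigma.-measurable = F t.
Proof. by move=> t0; apply: measurable_g_measurableTypeE; apply: F_filt.1. Qed.

Lemma filtration_measurable t E : 0 <= t -> F t E -> measurable E.
Proof. by move=> t0; exact: (F_filt.2.1 t t0). Qed.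

Lemma filtrationW s t E : 0 <= s -> s <= t -> F s E -> F t E.
Proof. by move=> s0 st; exact: (F_filt.2.2 s t s0 st). Qed.

Lemma filtrationC t E : 0 <= t -> F t E -> F t (~` E).
Proof. by move=> t0; rewrite -(filtration_measurableE t0); exact: measurableC. Qed.

Lemma filtrationI t E H : 0 <= t -> F t E -> F t H -> F t (E `&` H).
Proof.
by move=> t0; rewrite -(filtration_measurableE t0); exact: measurableI.
Qed.

Lemma filtrationT t : 0 <= t -> F t setT.
Proof. by move=> t0; rewrite -(filtration_measurableE t0); exact: measurableT. Qed.

Lemma adapted_measurable_filtration Z s t : 0 <= s -> s <= t -> adapted F Z ->
  measurable_fun [set: g_sigma_algebraType (F t)] (Z s : g_sigma_algebraType (F t) -> R).
Proof.
move=> s0 st aZ _ B mB; rewrite setTI.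
rewrite filtration_measurableE ?(le_trans s0 st)//.
by apply: (filtrationW s0 st); exact: aZ.
Qed.

Lemma filtration_le_set t (f : T -> R) c : 0 <= t ->
  measurable_fun [set: g_sigma_algebraType (F t)] (f : g_sigma_algebraType (F t) -> R) ->
  F t [set w | f w <= c].
Proof.
move=> t0 mf; rewrite -(filtration_measurableE t0).
rewrite (_ : [set w | _] = setT `&` f @^-1` `]-oo, c]%classic).
  exact: mf.
by apply/seteqP; split => w /=; rewrite in_itv//= => -[].
Qed.

Lemma adapted_measurable Z t : 0 <= t -> adapted F Z ->
  measurable_fun [set: T] (Z t).
Proof.
by move=> t0 aZ _ B mB; rewrite setTI; apply: (filtration_measurable t0); exact: aZ.
Qed.

(** Times with values in [s, u] that are optional for the filtration: only the
    strict events [eta < t] are required to belong to [F t]. This weakening of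
    stopping times covers first exit times of continuous adapted processes
    without any right-continuity or completeness of the filtration. *)
Definition optional_time s u eta : Prop :=
  (forall w, s <= eta w <= u) /\
  forall t, s < t -> t <= u -> F t [set w | eta w < t].

Section discretization.
Variables (s u : R) (eta : T -> R).
Hypotheses (s0 : 0 <= s) (su : s < u) (eta_opt : optional_time s u eta).

(* The time [eta] is rounded up to the regular grid with [m.+1] steps: the
   rounded time is [grid m (idx m w).+1]. The [minn] puts the case [eta w = u]
   in the last step. *)
Let mesh m : R := (u - s) / m.+1%:R.
Let grid m i : R := s + i%:R * mesh m.
Let idx m w : nat := minn m (Num.truncn ((eta w - s) / mesh m)).

Let mesh_gt0 m : 0 < mesh m.
Proof. by rewrite /mesh divr_gt0// subr_gt0. Qed.

Let grid_max m : grid m m.+1 = u.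
Proof. by rewrite /grid /mesh mulrC divfK// addrC subrK. Qed.

Let grid_le m i : (i <= m.+1)%N -> grid m i <= u.
Proof.
move=> im; rewrite -(grid_max m) /grid lerD2l ler_wpM2r ?ler_nat//.
exact: ltW.
Qed.

Let grid_ge m i : s <= grid m i.
Proof. by rewrite /grid lerDl mulr_ge0// ltW. Qed.

Let idxP m w : grid m (idx m w) <= eta w <= grid m (idx m w).+1.
Proof.
have [+ _] := eta_opt => /(_ w)/andP[sw wu].
have q0 : 0 <= (eta w - s) / mesh m by rewrite divr_ge0 ?subr_ge0// ltW.
have /andP[q1 q2] := truncn_itv q0; rewrite /idx.
have -> : (grid m (minn m (Num.trunc ((eta w - s) / mesh m))) <= eta w).
  rewrite /grid -lerBrDl -ler_pdivlMr//; apply: le_trans q1.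
  by rewrite ler_nat geq_minr.
rewrite /=; have [mt|tm] := leqP m (Num.trunc ((eta w - s) / mesh m)).
  by rewrite grid_max.
by rewrite /grid -lerBlDl -ler_pdivrMr// ltW.
Qed.

Let idx_le m w : (idx m w <= m)%N.
Proof. exact: geq_minl. Qed.

(* The event that the index is [i] is decided by time [grid m i.+1]. *)
Let idx_filtration m i : (i <= m)%N ->
  F (grid m i.+1) [set w | idx m w = i].
Proof.
have F_ge k : (k <= m)%N -> F (grid m k) [set w | (k <= idx m w)%N].
  move=> km; have gk0 : 0 <= grid m k by exact: le_trans (grid_ge _ _).
  have [->|k0] := posnP k.
    rewrite (_ : [set _ | _] = setT); first by apply: filtrationT; exact: le_trans (grid_ge _ _).
    by apply/seteqP; split.
  rewrite (_ : [set _ | _] = ~` [set w | eta w < grid m k]).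
    apply: filtrationC => //; apply: eta_opt.2.
      by rewrite /grid ltrDl mulr_gt0// ltr0n.
    by apply: grid_le; exact: leqW.
  apply/seteqP; split => w /=.
    move=> kw; apply/negP; rewrite -leNgt; have /andP[+ _] := idxP m w.
    by apply: le_trans; rewrite /grid lerD2l ler_wpM2r ?ler_nat ?ltW.
  move=> /negP; rewrite -leNgt => kw; rewrite /idx leq_min km/=.
  rewrite truncn_ge_nat; last first.
    have [+ _] := eta_opt => /(_ w)/andP[sw _].
    by rewrite divr_ge0 ?subr_ge0// ltW.
  by rewrite ler_pdivlMr// lerBrDl.
move=> im; have gi0 : 0 <= grid m i.+1 by exact: le_trans (grid_ge _ _).
rewrite (_ : [set _ | _] = [set w | (i <= idx m w)%N] `&` ~` [set w | (i < idx m w)%N]).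
  apply: filtrationI => //.
    apply: (@filtrationW (grid m i)); last exact: F_ge.
      exact: le_trans (grid_ge _ _).
    by rewrite /grid lerD2l ler_wpM2r ?ler_nat// ltW.
  move: im; rewrite leq_eqVlt => /predU1P[->|im]; last exact/filtrationC/F_ge.
  rewrite (_ : [set _ | _] = set0).
    by rewrite setC0; apply: filtrationT; exact: le_trans (grid_ge _ _).
  by rewrite -subset0 => w /=; rewrite ltnNge idx_le.
apply/seteqP; split => w /=; first by move=> ->; rewrite ltnn.
by move=> [iw /negP]; rewrite -leqNgt => wi; apply/eqP; rewrite eqn_leq iw wi.
Qed.


Let idx_cvg w : grid m (idx m w).+1 @[m --> \oo] --> eta w.
Proof.
apply/cvgrPdist_le => e e0.
have h0 : mesh m @[m --> \oo] --> 0.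
  rewrite /mesh -[X in _ --> X](mulr0 (u - s)).
  by apply: cvgM; [exact: cvg_cst|exact: cvg_harmonic].
move/cvgrPdist_le : h0 => /(_ e e0); apply: filterS => m.
rewrite sub0r normrN gtr0_norm// => me; rewrite distrC ger0_norm; last first.
  by rewrite subr_ge0; have /andP[_] := idxP m w.
apply: le_trans me; rewrite lerBlDr; have /andP[+ _] := idxP m w.
by rewrite /grid -natr1 mulrDl mul1r addrA [mesh m + _]addrC lerD2r.
Qed.

Let idx_process_cvg Z w : {within `[0, +oo[, continuous (Z ^~ w)} ->
  Z (grid m (idx m w).+1) w @[m --> \oo] --> Z (eta w) w.
Proof.
move=> cZ; apply: (within_continuous_cvg cZ _ _ (idx_cvg (w := w))).
  by have [+ _] := eta_opt => /(_ w)/andP[+ _]; exact: le_trans.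
by move=> m; exact: le_trans (grid_ge _ _).
Qed.

(** The process sampled at an optional time is the pointwise limit of the
    process sampled at the rounded times, which are simple. *)
Lemma optional_time_measurable Z : adapted F Z -> continuous_process Z ->
  measurable_fun [set: T] (fun w => Z (eta w) w).
Proof.
move=> aZ cZ; pose S m i : set T := [set w | idx m w = i].
have gE m w : \sum_(i < m.+1) (Z (grid m i.+1) \_ (S m i)) w =
    Z (grid m (idx m w).+1) w.
  have idx_lt : (idx m w < m.+1)%N by rewrite ltnS.
  rewrite (bigD1 (Ordinal idx_lt))//= big1 ?addr0 => [|i /eqP ni].
    by rewrite patchE mem_set.
  rewrite patchE memNset// => ii; apply: ni.
  by apply: val_inj; rewrite /= -ii.
apply: (@measurable_fun_cvg _ _ _ setT
  (fun m w => \sum_(i < m.+1) (Z (grid m i.+1) \_ (S m i)) w)).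
  move=> m; apply: measurable_sum => i.
  have g0 : 0 <= grid m i.+1 by exact: le_trans (grid_ge _ _).
  have mS : measurable (S m i).
    by apply: (filtration_measurable g0); apply: idx_filtration; rewrite -ltnS.
  apply/(measurable_restrictT _ mS).
  by apply: measurable_funTS; exact: adapted_measurable.
move=> w _ /=; under eq_fun do rewrite gE.
exact: (idx_process_cvg (@cZ w)).
Qed.

Section martingale_stopping.
Variables (Z : R -> T -> R) (H : set T) (B : R).
Hypotheses (mZ : martingale F P Z) (cZ : continuous_process Z) (FH : F s H).
Hypothesis Z_bnd : forall w, H w -> `|Z (eta w) w - Z s w| <= B.

(* The truncation at level [B + 1] disappears in the limit, since [Z] at [eta]
   stays within [B] of [Z s], and makes the sampled values bounded, so that no
   uniform integrability argument is needed. *)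
Let S m i : set T := [set w | idx m w = i] `&`
  [set w | `|Z (grid m i.+1) w - Z s w| <= B + 1].

Let S_filtration m i : (i <= m)%N -> F (grid m i.+1) (S m i).
Proof.
move=> im; have g0 : 0 <= grid m i.+1 by exact: le_trans (grid_ge _ _).
apply: filtrationI => //; first exact: idx_filtration.
have aZ := mZ.1; apply: filtration_le_set => //.
apply: measurableT_comp => //; apply: measurable_funB.
  exact: adapted_measurable_filtration.
exact: adapted_measurable_filtration.
Qed.

Let mH : measurable H. Proof. exact: (filtration_measurable s0). Qed.

Let mS m i : (i <= m)%N -> measurable (S m i).
Proof.
by move=> im; apply/(filtration_measurable _ (S_filtration im))/(le_trans s0).
Qed.

Let u0 : 0 <= u. Proof. exact/(le_trans s0)/ltW. Qed.

Let q m i : T -> R := (fun w => Z (grid m i.+1) w - Z u w) \_ (S m i).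

Let int_q m i : (i <= m)%N -> P.-integrable H (EFin \o q m i).
Proof.
move=> im; rewrite /q -restrict_EFin; apply/integrable_restrict => //.
  exact: mS.
apply: (@integrableS _ _ _ _ setT) => //; first exact: measurableI (mS im).
by apply: (@integrableB _ _ _ _ _ _ (EFin \o Z (grid m i.+1)) (EFin \o Z u)) => //;
  apply: mZ.2.1 => //; exact: le_trans (grid_ge _ _).
Qed.

Let q_eq0 m i : (i <= m)%N -> (\int[P]_(w in H) (q m i w)%:E = 0)%E.
Proof.
move=> im; have g0 : 0 <= grid m i.+1 by exact: le_trans (grid_ge _ _).
transitivity (\int[P]_(w in H `&` S m i) (Z (grid m i.+1) w - Z u w)%:E)%E.
  rewrite integral_mkcondr; apply: eq_integral => w _.
  by rewrite /q -[in RHS]/(_ \o _) restrict_EFin.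
have FHS : F (grid m i.+1) (H `&` S m i).
  by apply: filtrationI => //; [exact: filtrationW FH|exact: S_filtration].
have mHS := filtration_measurable g0 FHS.
have intZ t : 0 <= t -> P.-integrable (H `&` S m i) (EFin \o Z t).
  by move=> t0; apply: (@integrableS _ _ _ _ setT) => //; exact: mZ.2.1.
rewrite integralB_EFin//; [|exact: intZ..].
rewrite (mZ.2.2 _ u g0) ?grid_le// subee//.
exact: (integrable_fin_num mHS (intZ _ g0)).
Qed.

Let g m w : R := \sum_(i < m.+1) q m i w.

Let gE m w : g m w = let r := grid m (idx m w).+1 in
  if `|Z r w - Z s w| <= B + 1 then Z r w - Z u w else 0.
Proof.
have idx_lt : (idx m w < m.+1)%N by rewrite ltnS.
rewrite /g (bigD1 (Ordinal idx_lt))//= big1 ?addr0 => [|i /eqP ni].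
  rewrite /q patchE /S; case: ifPn.
    by rewrite inE => -[_ /= ->].
  by rewrite notin_setE/= => nS; case: ifPn => // ZB; case: nS.
rewrite /q patchE memNset// => -[/= ii _]; apply: ni.
by apply: val_inj; rewrite /= ii.
Qed.

Let int_g m : (\int[P]_(w in H) (g m w)%:E = 0)%E.
Proof.
transitivity (\int[P]_(w in H) (\sum_(i < m.+1) (q m i w)%:E))%E.
  by apply: eq_integral => w _; rewrite /g sumEFin.
have {1}-> : (fun w => \sum_(i < m.+1) (q m i w)%:E)%E =
    (fun w => \sum_(i < m.+1) (EFin \o q m i) w)%E by [].
rewrite integral_sum//; last by move=> i; apply: int_q; rewrite -ltnS.
by rewrite big1// => i _; apply: q_eq0; rewrite -ltnS.
Qed.

Let g_cvg w : H w -> g m w @[m --> \oo] --> Z (eta w) w - Z u w.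
Proof.
move=> Hw; pose r m := grid m (idx m w).+1.
have Zr : Z (r m) w @[m --> \oo] --> Z (eta w) w.
  exact: (idx_process_cvg (@cZ w)).
have ZrB : \forall m \near \oo, `|Z (r m) w - Z s w| <= B + 1.
  have /cvgrPdist_le/(_ 1 ltr01) : Z (r m) w - Z s w @[m --> \oo] --> Z (eta w) w - Z s w.
    by apply: cvgB => //; exact: cvg_cst.
  apply: filterS => m; rewrite distrC => hm.
  rewrite -[X in `|X|](subrK (Z (eta w) w - Z s w)) addrC.
  by rewrite (le_trans (ler_normD _ _))// lerD// Z_bnd.
have : (fun m => Z (r m) w - Z u w) @ \oo --> Z (eta w) w - Z u w.
  by apply: cvgB => //; exact: cvg_cst.
apply: cvg_trans; apply: near_eq_cvg; apply: filterS ZrB => m rB.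
by rewrite gE /= rB.
Qed.

(** The truncated sums [g m] have zero mean because each of their events is
    known at the corresponding grid time; they converge boundedly, up to the
    integrable term [Z s - Z u], to [Z eta - Z u]. *)
Lemma martingale_optional_stopping :
  P.-integrable H (EFin \o (fun w => Z (eta w) w - Z s w)) /\
  (\int[P]_(w in H) (Z (eta w) w - Z s w)%:E = 0)%E.
Proof.
have mg m : measurable_fun H (EFin \o g m).
  apply/measurable_EFinP; apply: measurable_sum => i.
  have im : (i <= m)%N by rewrite -ltnS.
  by have /measurable_int/measurable_EFinP := int_q im.
have intZ t : 0 <= t -> P.-integrable H (EFin \o Z t).
  by move=> t0; apply: (@integrableS _ _ _ _ setT) => //; exact: mZ.2.1.
have mlim : measurable_fun H (EFin \o (fun w => Z (eta w) w - Z u w)).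
  apply: (emeasurable_fun_cvg (fun m => EFin \o g m)) => // w Hw.
  by apply: cvg_EFin; [exact: nearW|exact: g_cvg].
pose G w := (`|B + 1|%:E + `|(Z s w)%:E - (Z u w)%:E|)%E.
have iG : P.-integrable H G.
  apply: integrableD => //; first exact: finite_measure_integrable_cst.
  by apply: integrable_abse; apply: integrableB => //; exact: intZ.
have [] := @dominated_convergence _ T R P H mH (fun m => EFin \o g m)
  (EFin \o (fun w => Z (eta w) w - Z u w)) G mg mlim _ iG.
- by apply: aeW => w Hw; apply: cvg_EFin; [exact: nearW|exact: g_cvg].
- apply: aeW => w m Hw /=; rewrite gE /G /=.
  case: ifPn => [ZB|_]; last by rewrite normr0 lee_fin addr_ge0.
  rewrite lee_fin -(subrKA (Z s w)) (le_trans (ler_normD _ _))// lerD//.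
  by apply: (le_trans ZB); exact: ler_norm.
move=> int_lim _ int_cvg.
have lim0 : (\int[P]_(w in H) (Z (eta w) w - Z u w)%:E = 0)%E.
  have /cvg_lim <- // := int_cvg.
  rewrite (_ : [sequence _]_n = cst 0%E) ?lim_cst//.
  by apply/funext => m /=; rewrite int_g.
have ZE : EFin \o (fun w => Z (eta w) w - Z s w) =
    (EFin \o (fun w => (Z (eta w) w - Z u w)%R) \- (fun w => (Z s w)%:E - (Z u w)%:E))%E.
  by apply/funext => w /=; congr EFin; ring.
have int_us : P.-integrable H (fun w => (Z s w)%:E - (Z u w)%:E)%E.
  by apply: integrableB => //; exact: intZ.
split; first by rewrite ZE; exact: integrableB.
transitivity (\int[P]_(w in H) (EFin \o (fun w => (Z (eta w) w - Z s w)%R)) w)%E => //.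
rewrite ZE integralB// lim0 integralB_EFin//; [|exact: intZ..].
rewrite (mZ.2.2 _ u s0 (ltW su) _ FH) subee ?subr0 ?sube0//.
exact: (integrable_fin_num mH (intZ _ s0)).
Qed.

End martingale_stopping.
End discretization.
End optional_stopping.

(** * Optional stopping for continuous local martingales *)

Section local_martingale_stopping.
Context {R : realType} {d : measure_display} {T : measurableType d}.
Variables (P : probability T R) (F : R -> set (set T)).
Hypothesis F_filt : filtration F.
Implicit Types (V M A : R -> T -> R) (eta : T -> R) (tau : T -> \bar R) (H : set T).

Lemma fine_mineE (t : R) (x : \bar R) : 0 <= t -> (0 <= x)%E ->
  fine (mine t%:E x) = if (t%:E <= x)%E then t else fine x.
Proof.
move=> t0; case: x => [r|_|]//=; last by rewrite /Order.min ltry leey.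
by rewrite -EFin_min lee_fin minEle; case: ifP.
Qed.

Lemma continuous_stopped V tau : (forall w, (0 <= tau w)%E) ->
  continuous_process V -> continuous_process (stopped V tau).
Proof.
move=> tau0 cV w; have tw0 := tau0 w; apply/within_continuous_itvcyP => t t0 e e0.
have fine_ge0 r : 0 <= r -> 0 <= fine (mine r%:E (tau w)).
  by move=> r0; rewrite fine_mineE//; case: ifP => // _; exact: fine_ge0.
have /within_continuous_itvcyP/(_ _ (fine_ge0 t t0) e e0)[del del0 dd] := cV w.
exists del => // r r0 tr; apply: dd; first exact: fine_ge0.
apply: le_lt_trans tr; rewrite !fine_mineE//.
case: (tau w) tw0 => [x||]//= _; last by rewrite !leey.
have := ler_norm (t - r); have := ler_norm (r - t); rewrite (distrC r).
by rewrite !lee_fin ler_norml; case: (leP t x); case: (leP r x) => *; lra.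
Qed.

(** A bound on the increments up to [eta] makes the localization harmless: the
    stopped martingales obey the same bound, and dominated convergence removes
    the localizing times. *)
Lemma local_martingale_optional_stopping V eta s u H B :
  continuous_local_martingale F P V -> 0 <= s -> s < u ->
  optional_time F s u eta -> F s H ->
  (forall w t, H w -> s <= t -> t <= eta w -> `|V t w - V s w| <= B) ->
  P.-integrable H (EFin \o (fun w => V (eta w) w - V s w)) /\
  (\int[P]_(w in H) (V (eta w) w - V s w)%:E = 0)%E.
Proof.
move=> [aV [cV [tau [tau_st [_ [tau_cvg mV]]]]]] s0 su eta_opt FH V_bnd.
have mH := filtration_measurable F_filt s0 FH.
have eta_itv w : s <= eta w <= u by exact: eta_opt.1.
have meta : measurable_fun setT (fun w => V (eta w) w).
  exact: (optional_time_measurable F_filt s0 su eta_opt aV cV).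
have mVs : measurable_fun setT (V s) by exact: (adapted_measurable F_filt s0 aV).
have mdV : measurable_fun H (EFin \o (fun w => V (eta w) w - V s w)).
  by apply/measurable_EFinP/measurable_funTS/measurable_funB.
have iB : P.-integrable H (EFin \o cst `|B|).
  exact: finite_measure_integrable_cst.
have dV_bnd w : H w -> `|V (eta w) w - V s w| <= B.
  by move=> Hw; have /andP[se _] := eta_itv w; exact: V_bnd.
split.
  apply: le_integrable iB => // w Hw /=.
  by rewrite lee_fin normr_id (le_trans (dV_bnd w Hw)) ?ler_norm.
pose Z n t w := stopped V (tau n) t w - V 0 w.
have cZ n : continuous_process (Z n).
  move=> w x; apply: cvgB; last exact: cvg_cst.
  by apply: (@continuous_stopped V (tau n)) => // w'; exact: (tau_st n).1.
have Z_bnd n w : H w -> `|Z n (eta w) w - Z n s w| <= B.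
  move=> Hw; have /andP[se eu] := eta_itv w.
  have B0 : 0 <= B by apply: le_trans (dV_bnd w Hw).
  rewrite /Z [X in `|X|](_ : _ = stopped V (tau n) (eta w) w - stopped V (tau n) s w); last by ring.
  have tau0 := (tau_st n).1 w.
  rewrite /stopped !fine_mineE ?(le_trans s0)//.
  case: ifPn => et; case: ifPn => st.
  - exact: dV_bnd.
  - by move: st; rewrite (le_trans _ et) ?lee_fin.
  - move: et st; rewrite -ltNge; case: (tau n w) tau0 => //= r r0.
    by rewrite lte_fin lee_fin => re sr; apply: V_bnd => //; exact: ltW.
  - by rewrite subrr normr0.
have Z0 n := martingale_optional_stopping F_filt s0 su eta_opt (mV n) (@cZ n) FH (@Z_bnd n).
have [] := @dominated_convergence _ T R P H mH
  (fun n => EFin \o (fun w => Z n (eta w) w - Z n s w))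
  (EFin \o (fun w => V (eta w) w - V s w)) (EFin \o cst `|B|) _ mdV _ iB.
- by move=> n; exact: measurable_int (Z0 n).1.
- move: tau_cvg; apply: filterS => w tauw Hw.
  have /andP[se eu] := eta_itv w.
  have u_tau : \forall n \near \oo, (u%:E <= tau n w)%E.
    by move/cvgeyPge : tauw => /(_ u).
  apply: cvg_near_cst; apply: filterS u_tau => n un /=.
  congr EFin; rewrite /Z /stopped !fine_mineE ?(le_trans s0) ?(tau_st n).1//.
  rewrite !ifT ?(le_trans _ un) ?lee_fin//; last exact: le_trans eu.
  by ring.
- apply: aeW => w n Hw /=; rewrite lee_fin.
  by rewrite (le_trans (Z_bnd n w Hw))// ler_norm.
move=> _ _ Vcvg; have /cvg_lim <- // := Vcvg.
rewrite (_ : [sequence _]_n = cst 0%E) ?lim_cst//.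
by apply/funext => n /=; rewrite (Z0 n).2.
Qed.

End local_martingale_stopping.

(** * A maximal inequality in terms of the quadratic variation *)

Section maximal_inequality.
Context {R : realType} {d : measure_display} {T : measurableType d}.
Variables (P : probability T R) (F : R -> set (set T)).
Hypothesis F_filt : filtration F.
Variables (M A : R -> T -> R) (s u a b : R).
Hypotheses (M_clm : continuous_local_martingale F P M)
  (A_qv : quadratic_variation F P M A).
Hypotheses (s0 : 0 <= s) (su : s < u) (a0 : 0 < a) (b0 : 0 < b).

Let aM : adapted F M. Proof. exact: M_clm.1. Qed.
Let cM : continuous_process M. Proof. exact: M_clm.2.1. Qed.
Let aA : adapted F A. Proof. exact: A_qv.1. Qed.
Let cA : continuous_process A. Proof. exact: A_qv.2.1. Qed.

(* [eta] is the exit time, within [s, u], from the range where [M] has moved by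
   at most [a / 2] and its quadratic variation has grown by at most [b]. *)
Let exited w t := a / 2 < `|M t w - M s w| \/ b < A t w - A s w.

Let exits w : set R := [set t | t = u \/ s <= t < u /\ exited w t].

Let eta w := inf (exits w).

Let exits_lb w : lbound (exits w) s.
Proof. by move=> t [->|[/andP[]]]//; exact: ltW. Qed.

Let exits_inf w : has_inf (exits w).
Proof. by split; [exists u; left|exists s; exact: exits_lb]. Qed.

Let eta_le w t : exits w t -> eta w <= t.
Proof. by move=> et; apply: ge_inf et; exact: (exits_inf w).2. Qed.

Let eta_itv w : s <= eta w <= u.
Proof.
apply/andP; split; last by apply: eta_le; left.
by apply: lb_le_inf; [exact: (exits_inf w).1|exact: exits_lb].
Qed.

Let exited_open w (t : R) : 0 <= t -> exited w t -> exists2 del : R, 0 < del &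
  forall r, 0 <= r -> `|t - r| < del -> exited w r.
Proof.
move=> t0 [Mt|At].
  have /within_continuous_itvcyP/(_ t t0 (`|M t w - M s w| - a / 2))[|del del0 dd] := @cM w.
    by rewrite subr_gt0.
  exists del => // r r0 tr; left; have := dd r r0 tr.
  have := ler_normD (M t w - M r w) (M r w - M s w).
  by rewrite addrA subrK => *; lra.
have /within_continuous_itvcyP/(_ t t0 (A t w - A s w - b))[|del del0 dd] := @cA w.
  by rewrite subr_gt0.
exists del => // r r0 tr; right; have := dd r r0 tr.
by have := ler_norm (A t w - A r w) => *; lra.
Qed.

Let exited_filtration (t : R) : s <= t -> F t [set w | exited w t].
Proof.
move=> st; have t0 : 0 <= t by exact: le_trans st.
have mN : measurable_fun [set: g_sigma_algebraType (F t)]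
    (fun w : g_sigma_algebraType (F t) => `|M t w - M s w|).
  by apply: measurableT_comp => //; apply: measurable_funB;
    exact: adapted_measurable_filtration.
have mA : measurable_fun [set: g_sigma_algebraType (F t)]
    (fun w : g_sigma_algebraType (F t) => A t w - A s w).
  by apply: measurable_funB; exact: adapted_measurable_filtration.
rewrite (_ : [set _ | _] = ~` ([set w | `|M t w - M s w| <= a / 2] `&`
    [set w | A t w - A s w <= b])).
  by apply: filtrationC => //; apply: filtrationI => //; apply: filtration_le_set.
apply/seteqP; split => w /=.
  by rewrite !leNgt => -[Mt|At] [/negP + /negP]; [rewrite Mt|rewrite At].
by move=> /not_andP[]/negP; rewrite -ltNge; [left|right].
Qed.

Let eta_optional : optional_time F s u eta.
Proof.
split=> // t st tu; have t0 : 0 <= t by apply: le_trans (ltW st).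
rewrite (_ : [set _ | _] = \bigcup_(q : rat)
    if s <= ratr q < t then [set w | exited w (ratr q)] else set0).
  rewrite -(filtration_measurableE F_filt t0); apply: bigcupT_measurable_rat => q.
  rewrite (filtration_measurableE F_filt t0); case: ifPn => [/andP[sq qt]|_].
    by apply: (filtrationW F_filt _ (ltW qt)); [exact: le_trans sq|exact: exited_filtration].
  by rewrite -(filtration_measurableE F_filt t0).
apply/seteqP; split => w /=.
  move=> /(inf_lt (exits_inf w).1)[r [->|[/andP[sr ru] er]] rt].
    by move: rt; rewrite ltNge tu.
  have r0 : 0 <= r by exact: le_trans sr.
  have [del del0 dd] := exited_open r0 er.
  have : r < Num.min t (r + del) by rewrite lt_min rt ltrDl del0.
  move=> /rat_in_itvoo[q]; rewrite in_itv/= lt_min => /andP[rq /andP[qt qd]].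
  exists q => //; rewrite (le_trans sr (ltW rq)) qt/=.
  apply: dd; first exact: le_trans (ltW rq).
  by rewrite ltr0_norm ?subr_lt0// opprB ltrBlDl.
move=> [q _]; case: ifPn => // /andP[sq qt] eq.
have qu := lt_le_trans qt tu.
by apply: le_lt_trans qt; apply: eta_le; right; rewrite sq qu.
Qed.

Let before_eta w (t : R) : s <= t -> t <= eta w ->
  `|M t w - M s w| <= a / 2 /\ A t w - A s w <= b.
Proof.
move=> st te; suff : ~ exited w t.
  by move=> /not_orP[/negP + /negP]; rewrite -!leNgt.
move=> et; have t0 : 0 <= t by exact: le_trans st.
have {}st : s < t.
  rewrite lt_neqAle st andbT; apply/eqP => ts; move: et.
  by rewrite -ts /exited !subrr normr0 => -[]; rewrite ltNge ltW// divr_gt0.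
have [del del0 dd] := exited_open t0 et.
pose r := Num.max s (t - del / 2).
have rt : r < t by rewrite gt_max st; lra.
have sr : s <= r by rewrite le_max lexx.
have : eta w <= r.
  apply: eta_le; right; split.
    by rewrite sr (lt_le_trans rt)// (le_trans te)//; have /andP[] := eta_itv w.
  apply: dd; first exact: le_trans sr.
  rewrite gtr0_norm ?subr_gt0// ltrBlDl -ltrBlDr /r lt_max.
  by apply/orP; right; lra.
by move=> /(le_trans te); rewrite leNgt rt.
Qed.

Let E : set T := [set w | a / 2 <= `|M (eta w) w - M s w|].

Let E_sub w (v : R) : s <= v -> v <= u -> a <= `|M v w - M s w| ->
  A v w - A s w <= b -> E w.
Proof.
have a_gt0 : 0 < a by [].
move=> sv vu Mv Av; rewrite /E /= leNgt; apply/negP => Me.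
have eta0 : 0 <= eta w by have /andP[+ _] := eta_itv w; exact: le_trans.
have /within_continuous_itvcyP/(_ _ eta0 (a / 2 - `|M (eta w) w - M s w|))[|del del0 dd] := @cM w.
  by rewrite subr_gt0.
have near_eta r : eta w <= r -> r < eta w + del -> `|M r w - M s w| < a / 2.
  move=> er rd; have := dd r (le_trans eta0 er).
  rewrite ler0_norm ?subr_le0// opprB ltrBlDl => /(_ rd).
  have := ler_normD (M r w - M (eta w) w) (M (eta w) w - M s w).
  by rewrite addrA subrK (distrC (M r w) (M (eta w) w)) => *; lra.
have ev : exits w v.
  have [->|vu'] := eqVneq v u; first by left.
  by right; rewrite sv lt_neqAle vu' vu; split=> //; left; lra.
have [r er rd] := inf_adherent del0 (exits_inf w).
have Mr := near_eta r (eta_le er) rd.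
have [rv|vr] := leP r v; last first.
  by have := near_eta v (eta_le ev) (lt_trans vr rd); lra.
case: er => [ru|[/andP[sr ru] [Mr'|Ar]]].
- have vr : v = r by apply/le_anti; rewrite rv ru vu.
  by move: Mv; rewrite vr => *; lra.
- by move: Mr; rewrite ltNge ltW.
- have := A_qv.2.2.1 w r v (le_trans s0 sr) rv; lra.
Qed.

Let mE : measurable E.
Proof.
rewrite (_ : E = setT `&` (fun w => `|M (eta w) w - M s w|) @^-1` `[a / 2, +oo[).
  have : measurable_fun [set: T] (fun w => `|M (eta w) w - M s w|).
    apply: measurableT_comp => //; apply: measurable_funB.
      exact: (optional_time_measurable F_filt s0 su eta_optional aM cM).
    exact: (adapted_measurable F_filt s0 aM).
  exact.
by apply/seteqP; split => w /=; rewrite in_itv/= andbT// => -[].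
Qed.

(* On a cell where [M s] is within [a / 4] and [sqrt b] of a constant [c],
   optional stopping applies to [(M - c) ^+ 2 - A], that is, up to a constant,
   to a combination of the local martingales [M ^+ 2 - A] and [M] with constant
   coefficients. *)
Let E_cell H c : F s H -> (forall w, H w -> `|M s w - c| <= a / 4) ->
  (forall w, H w -> (M s w - c) ^+ 2 <= b) ->
  ((a ^+ 2 / 16)%:E * P (H `&` E) <= (2 * b)%:E * P H)%E.
Proof.
have [a_gt0 b_gt0] : 0 < a /\ 0 < b by [].
move=> FH Hc Hb; have mH := filtration_measurable F_filt s0 FH.
pose Q t w := M t w ^+ 2 - A t w.
have Q_clm : continuous_local_martingale F P Q by exact: A_qv.2.2.2.2.
have [iM M0] : P.-integrable H (EFin \o (fun w => M (eta w) w - M s w)) /\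
    (\int[P]_(w in H) (M (eta w) w - M s w)%:E = 0)%E.
  apply: (local_martingale_optional_stopping F_filt (B := a / 2) M_clm s0 su eta_optional FH).
  by move=> w t _ st te; exact: (before_eta st te).1.
have [iQ Q0] : P.-integrable H (EFin \o (fun w => Q (eta w) w - Q s w)) /\
    (\int[P]_(w in H) (Q (eta w) w - Q s w)%:E = 0)%E.
  apply: (local_martingale_optional_stopping F_filt
    (B := a / 2 * (a / 2 + 2 * (a / 4 + `|c|)) + b) Q_clm s0 su eta_optional FH).
  move=> w t Hw st te; have [Mt At] := before_eta st te.
  have A0 := A_qv.2.2.1 w s t s0 st.
  have -> : Q t w - Q s w = (M t w - M s w) * (M t w - M s w + 2 * (M s w - c + c))
    - (A t w - A s w) by rewrite /Q; ring.
  rewrite (le_trans (ler_normB _ _))// lerD//; last by rewrite ger0_norm; lra.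
  rewrite normrM ler_pM// (le_trans (ler_normD _ _))// lerD//.
  rewrite normrM ger0_norm// ler_wpM2l// (le_trans (ler_normD _ _))// lerD//.
  exact: Hc.
pose f w := 2 * b + (Q (eta w) w - Q s w) - 2 * c * (M (eta w) w - M s w).
have f_ge w : H w -> (M (eta w) w - c) ^+ 2 <= f w.
  move=> Hw; have /andP[se eu] := eta_itv w.
  have [_ Ae] := before_eta se (lexx _).
  have := Hb w Hw; rewrite /f /Q => *; lra.
have ib : P.-integrable H (EFin \o cst (2 * b)).
  exact: finite_measure_integrable_cst.
have iM2 : P.-integrable H (EFin \o (fun w => 2 * c * (M (eta w) w - M s w))).
  exact: (integrableZl mH (2 * c) iM).
have iQb : P.-integrable H (EFin \o (fun w => 2 * b + (Q (eta w) w - Q s w))).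
  exact: (integrableD mH ib iQ).
have mf : measurable_fun H (EFin \o f).
  exact: (measurable_int P (integrableB mH iQb iM2)).
have int_f : (\int[P]_(w in H) (f w)%:E = (2 * b)%:E * P H)%E.
  rewrite integralB_EFin// integralD_EFin// Q0 adde0.
  under [X in (_ - X)%E]eq_integral do rewrite EFinM.
  by rewrite integralZl// M0 mule0 sube0 integral_cst.
have a16 : 0 < a ^+ 2 / 16 by rewrite divr_gt0// exprn_gt0.
have := le_integral_abse P mH mf a16.
rewrite [X in (_ <= X)%E -> _](_ : _ = \int[P]_(w in H) (f w)%:E)%E; last first.
  apply: eq_integral => w; rewrite inE => Hw /=; rewrite ger0_norm//.
  by apply: le_trans (f_ge w Hw); exact: sqr_ge0.
rewrite int_f; apply: le_trans; rewrite lee_pmul2l ?lte_fin//.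
apply: le_measure; rewrite ?inE.
- exact: measurableI.
- by apply: emeasurable_fun_c_infty => //; exact: measurableT_comp.
- move=> w [Hw Ew]; split => //=; rewrite lee_fin.
  apply: le_trans (ler_norm _); apply: le_trans (f_ge w Hw).
  have : a / 4 <= `|M (eta w) w - c|.
    have := Hc w Hw; have := ler_normD (M (eta w) w - c) (c - M s w).
    by rewrite addrA subrK (distrC c); move: Ew; rewrite /E /= => *; lra.
  move=> ac; have -> : a ^+ 2 / 16 = (a / 4) ^+ 2 by field.
  by rewrite -[leRHS]real_normK ?num_real// lerXn2r ?nnegrE//; lra.
Qed.

(** It is unlikely that [M] moves by [a] within [s, u] while its quadratic
    variation grows by at most [b], when [b] is small compared with [a ^+ 2].
    The random centre [M s] is frozen to a constant on each cell of a countable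
    partition, which avoids integrating its product with an increment of [M]. *)
Lemma local_martingale_maximal_inequality : exists E : set T,
  [/\ measurable E, (P E <= (32 * b / a ^+ 2)%:E)%E &
  forall w (v : R), s <= v -> v <= u -> a <= `|M v w - M s w| ->
    A v w - A s w <= b -> E w].
Proof.
have [a_gt0 b_gt0] : 0 < a /\ 0 < b by [].
exists E; split => //.
pose del := Num.min (a / 4) (Num.sqrt b).
have del0 : 0 < del by rewrite lt_min sqrtr_gt0 b0 divr_gt0.
(* The cells [H i] partition the sample space according to the value of [M s]
   up to [del]; they are indexed by the codes of integers. *)
pose H i := [set w | pickle (Num.floor (M s w / del)) = i].
have FH i : F s (H i).
  have [[l li]|nl] := pselect (exists l : int, pickle l = i); last first.
    rewrite (_ : H i = set0).
      by rewrite -setCT; apply: filtrationC => //; exact: filtrationT.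
    rewrite -subset0 => w Hi; apply: nl.
    by exists (Num.floor (M s w / del)).
  rewrite (_ : H i = M s @^-1` `[l%:~R * del, (l + 1)%:~R * del[).
    exact: aM s0 _ (measurable_itv _).
  apply/seteqP; split => w; rewrite /H /= in_itv/= -ler_pdivlMr// -ltr_pdivrMr//.
    by rewrite -li => /(pcan_inj pickleK) <-; exact: floor_itv.
  by move=> ll; rewrite -li; congr pickle; exact: floor_def.
have H_cell i : ((a ^+ 2 / 16)%:E * P (H i `&` E) <= (2 * b)%:E * P (H i))%E.
  have [[l li]|nl] := pselect (exists l : int, pickle l = i); last first.
    rewrite (_ : H i = set0) ?set0I ?measure0 ?mule0//.
    rewrite -subset0 => w Hi; apply: nl.
    by exists (Num.floor (M s w / del)).
  have Ml w : H i w -> `|M s w - l%:~R * del| <= del.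
    rewrite /H /= -li => /(pcan_inj pickleK) <-.
    have := floor_itv (M s w / del).
    rewrite ler_pdivlMr// ltr_pdivrMr// intrD mulrDl mul1r => /andP[l1 l2].
    by rewrite ger0_norm ?subr_ge0// lerBlDl ltW.
  apply: (E_cell (c := l%:~R * del)) => // w /Ml Hw.
    by apply: (le_trans Hw); rewrite ge_min lexx.
  rewrite -[leLHS]real_normK ?num_real// -[leRHS](sqr_sqrtr (ltW b_gt0)).
  by rewrite lerXn2r ?nnegrE ?sqrtr_ge0// (le_trans Hw)// ge_min lexx orbT.
have mH i : measurable (H i) by exact: filtration_measurable (FH i).
have tH : trivIset setT H by move=> i j _ _ [w [/= <- <-]].
have EH : E = \bigcup_i (H i `&` E).
  rewrite -setI_bigcupl (_ : \bigcup_i _ = setT) ?setTI//.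
  by apply/seteqP; split => w //= _; exists (pickle (Num.floor (M s w / del))).
have a16 : 0 < a ^+ 2 / 16 by rewrite divr_gt0// exprn_gt0.
have sumT (f : nat -> \bar R) :
    (\sum_(i <oo | i \in setT) f i = \sum_(i <oo) f i)%E.
  by apply: eq_eseriesl => i; rewrite in_setT.
have : ((a ^+ 2 / 16)%:E * P E <= (2 * b)%:E)%E.
  rewrite EH measure_bigcup//=; last 2 first.
    by move=> i _; exact: measurableI.
    by move=> i j _ _ [w [[/= <- _] [/= <- _]]].
  rewrite sumT -nneseriesZl//.
  apply: (@le_trans _ _ (\sum_(i <oo) (2 * b)%:E * P (H i))%E).
    by apply: lee_nneseries => // i _; rewrite mule_ge0// ltW.
  rewrite nneseriesZl//.
  rewrite -sumT -measure_bigcup//.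
  rewrite -[leRHS]mule1 lee_wpmul2l// ?lee_fin ?probability_le1//; first lra.
  exact: bigcup_measurable.
rewrite -lee_pdivlMl// -EFinM => /le_trans; apply.
rewrite lee_fin le_eqVlt; apply/orP; left; apply/eqP; field.
exact: lt0r_neq0.
Qed.

End maximal_inequality.

(** * Pathwise control on a time window *)

Section pathwise.
Context {R : realType}.
Notation mu := (@lebesgue_measure R).
Implicit Types (x b m g A : R -> R) (s t u v e r L D G : R).

(** Induction along a real interval: a property of the points of [s, u] that
    passes to the limit from the left and extends to the right holds
    everywhere. *)
Lemma real_induction (Q : R -> Prop) (s u : R) :
  (forall v : R, s <= v -> v <= u -> (forall r, s <= r -> r < v -> Q r) -> Q v) ->
  (forall v : R, s <= v -> v < u -> (forall r, s <= r -> r <= v -> Q r) ->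
     exists2 e : R, 0 < e & forall r, v < r -> r < v + e -> Q r) ->
  forall v, s <= v -> v <= u -> Q v.
Proof.
move=> Qcl Qop v sv vu; apply: contrapT => nQ.
pose S := [set t | s <= t /\ t <= v /\ ~ Q t].
have Sinf : has_inf S.
  by split; [exists v|exists s => t []].
have infv : inf S <= v by apply: ge_inf => //; exact: Sinf.2.
have sinf : s <= inf S by apply: lb_le_inf; [exact: Sinf.1|move=> t []].
have Qlt r : s <= r -> r < inf S -> Q r.
  move=> sr ri; apply: contrapT => nQr.
  have : S r by split=> //; split=> //; exact: le_trans (ltW ri) infv.
  by move=> /(ge_inf Sinf.2); rewrite leNgt ri.
have Qinf : Q (inf S) by apply: Qcl => //; exact: le_trans infv vu.
have infv' : inf S < v.
  by rewrite lt_neqAle infv andbT; apply/eqP => iv; apply: nQ; rewrite -iv.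
have [|e e0 Qe] := Qop _ sinf (lt_le_trans infv' vu).
  by move=> r sr; rewrite le_eqVlt => /predU1P[->//|]; exact: Qlt.
have [r [sr [rv nQr]] re] := inf_adherent e0 Sinf.
apply: nQr; have [ri|] := ltP (inf S) r; first exact: Qe.
by rewrite le_eqVlt => /predU1P[->//|]; exact: Qlt.
Qed.

Lemma Rintegral_le_cst b s t D : mu.-integrable `[s, t] (EFin \o b) -> s <= t ->
  (forall r, s <= r -> r < t -> b r <= D) ->
  \int[mu]_(r in `[s, t]) b r <= D * (t - s).
Proof.
move=> ib st bD.
have ib' : mu.-integrable `[s, t[ (EFin \o b).
  by apply: integrableS ib => //; apply: subset_itvl; rewrite bnd_simp.
have mst : mu `[s, t[%classic = (t - s)%:E.
  rewrite lebesgue_measure_itv/= lte_fin; case: ltP => // ts.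
  by rewrite (le_anti (introT andP (conj st ts))) subrr.
have msty : (mu `[s, t[%classic < +oo)%E by rewrite mst ltry.
rewrite -Rintegral_itv_bndo_bndc//.
have -> : D * (t - s) = \int[mu]_(r in `[s, t[) (cst D r).
  by rewrite Rintegral_cst//; congr (_ * _); exact: esym (congr1 fine mst).
apply: le_Rintegral => //.
  by apply: measurable_bounded_integrable => //; exact: bounded_cst.
by move=> r /=; rewrite in_itv/= => /andP[]; exact: bD.
Qed.

Lemma increments_le_below x b m s v D :
  increments_le x b m -> 0 <= s -> s <= v ->
  (forall r, s <= r -> r < v -> b r <= D) ->
  x v - x s <= D * (v - s) + (m v - m s).
Proof.
move=> incr s0 sv bD; have [ib xb] := incr s v s0 sv.
by rewrite (le_trans xb)// lerD2r; exact: Rintegral_le_cst.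
Qed.

(** A path whose increments are dominated can jump only downwards. *)
Lemma increments_le_right x b m s e :
  increments_le x b m -> {within `[0, +oo[, continuous m} -> 0 <= s -> 0 < e ->
  exists2 del : R, 0 < del & forall t, s < t -> t < s + del -> x t < x s + e.
Proof.
move=> incr /within_continuous_itvcyP cm s0 e0.
have s1 : s < s + 1 by rewrite ltrDl.
have [ib _] := incr s (s + 1) s0 (ltW s1).
have := parameterized_integral_cvg_left s1 ib.
move=> /cvgrPdist_lt/(_ (e / 2)) /=; rewrite divr_gt0// => /(_ isT).
move=> /nbhs_ballP[d1 /= d10 dd1].
have [d2 d20 dd2] := cm s s0 (e / 2) (divr_gt0 e0 (ltr0Sn _ 1)).
exists (Num.min d1 d2); first by rewrite lt_min d10.
move=> t st; rewrite -ltrBlDl lt_min => /andP[t1 t2].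
have [_ xb] := incr s t s0 (ltW st).
have st_norm : `|s - t| = t - s by rewrite ltr0_norm ?subr_lt0// opprB.
rewrite -ltrBlDl (le_lt_trans xb)// [ltRHS]splitr; apply: ltrD.
  apply: le_lt_trans (ler_norm _) _.
  have := dd1 t; rewrite /ball /= st_norm => /(_ t1).
  by rewrite sub0r normrN /parameterized_integral.
apply: le_lt_trans (ler_norm _) _; rewrite distrC; apply: dd2.
  exact: le_trans (ltW st).
by rewrite st_norm.
Qed.

(** As long as the drift is small below the level [L] and the noise moves by at
    most [L / 8], a path starting below [L / 8] does not reach [L]: it would have
    to cross the gap between [L / 2] and [L]. *)
Lemma small_drift_stays_below x b m s v L D :
  increments_le x b m -> {within `[0, +oo[, continuous m} ->
  0 <= s -> 0 < L -> 0 <= D ->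
  (forall t, s <= t -> t <= v -> x t <= L -> b t <= D) ->
  D * (v - s) <= L / 8 -> x s <= L / 8 ->
  (forall t, s <= t -> t <= v -> `|m t - m s| <= L / 8) ->
  forall t, s <= t -> t <= v -> x t <= L.
Proof.
move=> incr cm s0 L0 D0 bD DL xs mL.
have below r : s <= r -> r <= v -> (forall q, s <= q -> q < r -> x q <= L) ->
    x r <= L / 2.
  move=> sr rv xL.
  have : x r - x s <= D * (r - s) + (m r - m s).
    apply: (increments_le_below incr) => // q sq qr.
    by apply: bD => //; [exact: le_trans (ltW qr) rv|exact: xL].
  have : D * (r - s) <= D * (v - s) by rewrite ler_wpM2l// lerD2r.
  have := mL r sr rv; have := ler_norm (m r - m s) => *; lra.
apply: real_induction => r sr rv xL.
  by have := below r sr rv xL; lra.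
have xr : x r <= L / 2.
  by apply: below => // [|q sq qr]; [exact: ltW|apply: xL => //; exact: ltW].
have L2 : 0 < L / 2 by lra.
have [del del0 dd] := increments_le_right incr cm (le_trans s0 sr) L2.
by exists del => // t rt tr; have := dd t rt tr; lra.
Qed.

(** The dissipation in the drift pays for the quadratic variation: if its rate
    [g] is dominated by [D - b], then its growth is bounded through the
    decrease of [x] and the increment of the noise. *)
Lemma quadratic_increment_bound x b m A g s v L D G G' :
  increments_le x b m -> increments_le A g (fun=> 0) ->
  0 <= s -> s <= v -> 0 <= G' -> 0 <= x v ->
  (forall t, s <= t -> t <= v -> g t <= G + G' * (D - b t)) ->
  x s <= L / 8 -> m v - m s <= L / 8 ->
  A v - A s <= (G + G' * D) * (v - s) + G' * (L / 4).
Proof.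
move=> incr incrA s0 sv G'0 xv gG xs mv.
have [ib xb] := incr s v s0 sv; have [ig Ag] := incrA s v s0 sv.
have {}Ag : A v - A s <= \int[mu]_(r in `[s, v]) g r by move: Ag; rewrite subrr addr0.
apply: (le_trans Ag).
have mst : mu `[s, v]%classic = (v - s)%:E.
  rewrite lebesgue_measure_itv/= lte_fin; case: ltP => // ts.
  by rewrite (le_anti (introT andP (conj sv ts))) subrr.
have msty : (mu `[s, v]%classic < +oo)%E by rewrite mst ltry.
have ic : mu.-integrable `[s, v] (EFin \o cst (G + G' * D)).
  by apply: measurable_bounded_integrable => //; exact: bounded_cst.
have iGb : mu.-integrable `[s, v] (EFin \o (fun t => G' * b t)).
  exact: (integrableZl _ G' ib).
apply: (@le_trans _ _ (\int[mu]_(t in `[s, v]) (cst (G + G' * D) t - G' * b t))).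
  apply: le_Rintegral => //; first exact: (integrableB _ ic iGb).
  move=> t /=; rewrite in_itv/= => /andP[st tv].
  by rewrite (le_trans (gG t st tv))//= mulrBr addrA.
rewrite RintegralB// Rintegral_cst// [X in _ * X](congr1 fine mst) RintegralZl//.
rewrite lerD2l -mulrN.
by rewrite ler_wpM2l//; lra.
Qed.

(** A path that starts below [L / 8] and exceeds [L] must have seen the noise
    move by [L / 8] before its quadratic variation became large. *)
Lemma exit_small_quadratic_increment x b m A g s u L D G G' :
  increments_le x b m -> increments_le A g (fun=> 0) ->
  {within `[0, +oo[, continuous m} -> (forall t, 0 <= t -> 0 <= x t) ->
  0 <= s -> s <= u -> 0 < L -> 0 <= D -> 0 <= G -> 0 <= G' ->
  (forall t, s <= t -> t <= u -> x t <= L ->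
     b t <= D /\ g t <= G + G' * (D - b t)) ->
  D * (u - s) <= L / 8 -> x s <= L / 8 ->
  ~ (forall t, s <= t -> t <= u -> x t <= L) ->
  exists v, [/\ s <= v, v <= u, L / 8 <= `|m v - m s| &
    A v - A s <= (G + G' * D) * (u - s) + G' * (L / 4)].
Proof.
move=> incr incrA cm x0 s0 su L0 D0 G0 G'0 bgD DL xs nxL.
apply: contrapT => nv; apply: nxL.
have cm' := (within_continuous_itvcyP m).1 cm.
have L8 : 0 < L / 8 by lra.
have Dv v : v <= u -> D * (v - s) <= L / 8.
  by move=> vu; apply: le_trans DL; rewrite ler_wpM2l// lerD2r.
have xL v : s <= v -> v <= u ->
    (forall t, s <= t -> t <= v -> `|m t - m s| <= L / 8) ->
    forall t, s <= t -> t <= v -> x t <= L.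
  move=> sv vu; apply: (small_drift_stays_below incr cm s0 L0 D0) => //; last exact: Dv.
  by move=> t st tv xt; exact: (bgD t st (le_trans tv vu) xt).1.
suff mL : forall t, s <= t -> t <= u -> `|m t - m s| < L / 8.
  by apply: (xL u) => // t st tu; exact/ltW/mL.
apply: real_induction => v sv vu mv.
  have mv8 : `|m v - m s| <= L / 8.
    rewrite leNgt; apply/negP => mL.
    have [vs|vs] := eqVneq v s; first by move: mL; rewrite vs subrr normr0; lra.
    have {}vs : s < v by rewrite lt_neqAle eq_sym vs.
    have [|del del0 dd] := cm' v (le_trans s0 sv) (`|m v - m s| - L / 8).
      by rewrite subr_gt0.
    pose r := Num.max s (v - del / 2).
    have rv : r < v by rewrite gt_max vs; lra.
    have sr : s <= r by rewrite le_max lexx.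
    have := dd r (le_trans s0 sr); rewrite gtr0_norm ?subr_gt0// ltrBlDr -ltrBlDl.
    have -> : v - del < r by rewrite lt_max; apply/orP; right; lra.
    have := mv r sr rv; have := ler_normD (m v - m r) (m r - m s).
    by rewrite addrA subrK => ? ? /(_ isT); lra.
  rewrite lt_neqAle mv8 andbT; apply/eqP => mE; apply: nv; exists v; split => //.
    by rewrite mE.
  have mL t : s <= t -> t <= v -> `|m t - m s| <= L / 8.
    by move=> st; rewrite le_eqVlt => /predU1P[->//|tv]; exact/ltW/mv.
  apply: (@le_trans _ _ ((G + G' * D) * (v - s) + G' * (L / 4))).
    apply: (quadratic_increment_bound incr incrA) => //.
    - exact/x0/(le_trans s0).
    - move=> t st tv; apply: (bgD t st (le_trans tv vu) _).2.
      exact: xL mL _ st tv.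
    - exact: le_trans (ler_norm _) mv8.
  by rewrite lerD2r ler_wpM2l ?lerD2r// addr_ge0// mulr_ge0.
have mv' : `|m v - m s| < L / 8 by exact: mv.
have [|del del0 dd] := cm' v (le_trans s0 sv) (L / 8 - `|m v - m s|).
  by rewrite subr_gt0.
exists del => // r vr rv.
have := dd r (le_trans (le_trans s0 sv) (ltW vr)).
rewrite ltr0_norm ?subr_lt0// opprB ltrBlDl => /(_ rv).
have := ler_normD (m r - m v) (m v - m s).
by rewrite addrA subrK (distrC (m r) (m v)) => *; lra.
Qed.

End pathwise.

(** * Time averages and deterministic starting times *)

Section crossing_count.
Context {R : realType}.
Notation mu := (@lebesgue_measure R).
Implicit Types (x b m z : R -> R) (s t u v e r lam : R).

Lemma within_itv_uniformly_continuous z s u e :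
  {within `[s, u], continuous z} -> 0 < e ->
  exists2 del : R, 0 < del & forall r t, s <= r -> r <= t -> t <= u ->
    t - r < del -> `|z t - z r| < e.
Proof.
move=> /within_continuousP cz e0.
have [us|su] := ltP u s.
  by exists 1 => // r t sr rt tu; lra.
pose Q v := exists2 del : R, 0 < del & forall r t, s <= r -> r <= t -> t <= v ->
    t - r < del -> `|z t - z r| < e.
have Qloc v : s <= v -> v <= u -> (forall r, s <= r -> r < v -> Q r) ->
    exists2 del : R, 0 < del & forall v', v' <= u -> v' < v + del -> Q v'.
  move=> sv vu Qv.
  have [|del del0 dd] := cz v _ (e / 2) (divr_gt0 e0 (ltr0Sn _ 1)).
    by rewrite /= in_itv/= sv.
  have near_v r t : s <= r -> r <= u -> s <= t -> t <= u ->
      `|v - r| < del -> `|v - t| < del -> `|z t - z r| < e.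
    move=> sr ru st tu vr vt.
    have := dd r; rewrite /= in_itv/= sr ru => /(_ isT vr).
    have := dd t; rewrite /= in_itv/= st tu => /(_ isT vt).
    have := ler_normB (z v - z r) (z v - z t).
    by rewrite opprB addrC subrKA => *; lra.
  exists del => // v' v'u v'v.
  pose r0 := Num.max s (v - del / 2).
  have [d' d'0 dd'] : Q r0.
    have [vs|sv'] := leP v s.
      exists 1 => // r t sr rt tr _; have : r = t.
        apply/le_anti; rewrite rt/=; apply: (le_trans tr).
        rewrite ge_max sr/=; apply: le_trans sr; lra.
      by move=> ->; rewrite subrr normr0.
    apply: Qv; first by rewrite le_max lexx.
    by rewrite gt_max sv'; lra.
  exists (Num.min d' (del / 2)); first by rewrite lt_min d'0; lra.
  move=> r t sr rt tv'; rewrite lt_min => /andP[rt1 rt2].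
  have [tr0|] := leP t r0; first exact: dd'.
  rewrite gt_max => /andP[_ vt].
  apply: near_v => //.
  - exact: le_trans (le_trans rt tv') v'u.
  - exact: le_trans rt.
  - exact: le_trans v'u.
  - by rewrite ltr_norml; apply/andP; split; lra.
  - by rewrite ltr_norml; apply/andP; split; lra.
apply: (@real_induction _ Q s u) => // v sv vu Qv.
  have [del del0 dd] := Qloc v sv vu Qv.
  by apply: dd => //; rewrite ltrDl.
have [|del del0 dd] := Qloc v sv (ltW vu).
  by move=> r sr rv; apply: Qv => //; exact: ltW.
exists (Num.min del (u - v)); first by rewrite lt_min del0 subr_gt0.
move=> r vr; rewrite -ltrBlDl lt_min => /andP[rd ru].
by apply: dd; lra.
Qed.

(** Up to a nonincreasing function, [x] is a continuous function [W]. *)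
Lemma increments_le_dominated x b m u :
  increments_le x b m -> {within `[0, +oo[, continuous m} ->
  exists2 W : R -> R, {within `[0, u], continuous W} &
    forall s t, 0 <= s -> s <= t -> t <= u -> x t - W t <= x s - W s.
Proof.
move=> incr cm.
have [u0|u0] := ltP u 0.
  exists m; last by move=> s t; lra.
  by rewrite set_itv_ge ?bnd_simp -?ltNge//; exact: continuous_subspace0.
exists (fun t => parameterized_integral mu 0 t b + m t).
  move=> t; apply: cvgD.
    exact: (parameterized_integral_continuous u0 (incr 0 u (lexx _) u0).1).
  apply: (continuous_subspaceW _ cm).
  by apply: subset_itvl; rewrite bnd_simp.
move=> s t s0 st tu; have [_ xst] := incr s t s0 st.
have t0 : 0 <= t by exact: le_trans st.
have [ib _] := incr 0 t (lexx _) t0.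
have := Rintegral_itvB (x := s) ib; rewrite !bnd_simp => /(_ s0 st).
rewrite Rintegral_itv_obnd_cbnd; last first.
  by apply: integrableS ib => //; apply: subset_itv; rewrite bnd_simp.
rewrite /parameterized_integral => bE; move: xst; rewrite -bE.
move: (Rintegral _ _ _) => b1; move: (Rintegral _ _ _) => b2 *; lra.
Qed.

Lemma increments_le_integrable x b m u :
  increments_le x b m -> {within `[0, +oo[, continuous m} ->
  (forall t, 0 <= t -> 0 <= x t) ->
  mu.-integrable `[0, u] (EFin \o x).
Proof.
move=> incr cm x0; have [u0|u0] := ltP u 0.
  by rewrite set_itv_ge ?bnd_simp -?ltNge//; exact: integrable_set0.
have [W cW xW] := increments_le_dominated u incr cm.
apply: measurable_bounded_integrable => //.
- by rewrite /= lebesgue_measure_itv/=; case: ifP => _; rewrite ?ltry// lte_fin.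
- pose clamp t := Num.min (Num.max t 0) u.
  have clamp_itv t : 0 <= clamp t <= u by rewrite ge_min lexx orbT le_min u0 le_max lexx orbT.
  have mG : measurable_fun `[0, u] (fun t => x (clamp t) - W (clamp t)).
    apply: nonincreasing_measurable => // t t' tt'.
    have /andP[c0 _] := clamp_itv t; have /andP[_ cu] := clamp_itv t'.
    apply: xW => //; rewrite /clamp.
    by case: (leP t 0) => ?; case: (leP t' 0) => ?;
      rewrite !minEle; repeat case: ifP => ?; lra.
  have mW : measurable_fun `[0, u] W by exact: subspace_continuous_measurable_fun.
  apply: (eq_measurable_fun (fun t => (x (clamp t) - W (clamp t)) + W t)).
    move=> t; rewrite inE/= in_itv/= => /andP[t0 tu].
    by rewrite /clamp (max_idPl t0) (min_idPl tu) subrK.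
  exact: measurable_funD.
- have [c _ Wc] := EVT_max u0 cW.
  exists (x 0 - W 0 + W c); split; first exact: num_real.
  move=> M MB t /=; rewrite in_itv/= => /andP[t0 tu].
  rewrite ger0_norm ?x0//; apply: le_trans (ltW MB).
  have := xW 0 t (lexx _) t0 tu; have := Wc t; rewrite in_itv/= t0 tu => /(_ isT).
  by move=> *; lra.
Qed.

(** Riemann sums control the integral: since [x] cannot jump upwards, being
    above [lam] at a point of a fine grid forces it to be above [lam / 2] on the
    preceding grid step. *)
Lemma crossing_count_le x b m s u lam :
  increments_le x b m -> {within `[0, +oo[, continuous m} ->
  (forall t, 0 <= t -> 0 <= x t) -> 0 <= s -> s < u -> 0 < lam ->
  \forall N \near \oo,
    lam / 2 * ((u - s) / N.+1%:R) *
      \sum_(i < N.+1) (lam <= x (s + i.+1%:R * ((u - s) / N.+1%:R)))%R%:R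
    <= \int[mu]_(r in `[0, u]) x r.
Proof.
move=> incr cm x0 s0 su lam0.
have u0 : 0 <= u by lra.
have [W cW xW] := increments_le_dominated u incr cm.
have cW' : {within `[s, u], continuous W}.
  by apply: (continuous_subspaceW _ cW); apply: subset_itvr; rewrite bnd_simp.
have lam2 : 0 < lam / 2 by lra.
have [del del0 dW] := within_itv_uniformly_continuous cW' lam2.
have ix := increments_le_integrable u incr cm x0.
have h_cvg : (u - s) / N.+1%:R @[N --> \oo] --> 0.
  rewrite -[X in _ --> X](mulr0 (u - s)).
  by apply: cvgM; [exact: cvg_cst|exact: cvg_harmonic].
move/cvgrPdist_lt : h_cvg => /(_ del del0); apply: filterS => N.
rewrite sub0r normrN; set h := (u - s) / N.+1%:R.
have h0 : 0 < h by rewrite divr_gt0 ?subr_gt0.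
rewrite gtr0_norm// => hdel; pose g i := s + i%:R * h.
have g_max : g N.+1 = u by rewrite /g /h mulrC divfK// addrC subrK.
have gS i : g i.+1 = g i + h by rewrite /g -natr1 mulrDl mul1r addrA.
have gs i : s <= g i by rewrite lerDl mulr_ge0// ltW.
have g0 i : 0 <= g i by exact: le_trans (gs i).
have gu i : (i <= N.+1)%N -> g i <= u.
  by move=> iN; rewrite -g_max lerD2l ler_wpM2r ?ler_nat// ltW.
suff claim k : (k <= N.+1)%N ->
    lam / 2 * h * \sum_(i < k) (lam <= x (g i.+1))%R%:R <=
    \int[mu]_(r in `[0, g k]) x r.
  by rewrite -[X in `[0, X]]g_max; exact: claim.
elim: k => [_|k IH kN].
  rewrite big_ord0 mulr0; apply: Rintegral_ge0 => r /=.
  by rewrite in_itv/= => /andP[r0 _]; exact: x0.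
have gk := gu _ kN.
have ixk : mu.-integrable `[0, g k.+1] (EFin \o x).
  by apply: integrableS ix => //; apply: subset_itvl; rewrite bnd_simp.
have := Rintegral_itvB (x := g k) ixk; rewrite !bnd_simp => /(_ (g0 k)).
have gkk : g k <= g k.+1 by rewrite gS lerDl ltW.
move=> /(_ gkk)/eqP; rewrite subr_eq addrC => /eqP ->.
rewrite big_ord_recr/= mulrDr lerD ?IH// 1?ltnW//.
have [lamx|_] := leP lam; last first.
  rewrite mulr0; apply: Rintegral_ge0 => r /=.
  by rewrite in_itv/= => /andP[kr _]; apply: x0; exact: le_trans (g0 k) (ltW kr).
have mJ : mu `]g k, g k.+1]%classic = h%:E.
  by rewrite lebesgue_measure_itv/= lte_fin gS ltrDl h0 -EFinD addrAC subrr add0r.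
have -> : lam / 2 * h * 1 = \int[mu]_(r in `]g k, g k.+1]) cst (lam / 2) r.
  by rewrite Rintegral_cst// mulr1; congr (_ * _); exact: esym (congr1 fine mJ).
have mJy : (mu `]g k, g k.+1]%classic < +oo)%E by rewrite mJ ltry.
apply: le_Rintegral => //.
- by apply: measurable_bounded_integrable => //; exact: bounded_cst.
- by apply: integrableS ixk => //; apply: subset_itvr; rewrite bnd_simp.
- move=> r /=; rewrite in_itv/= => /andP[kr rk].
  have r0 : 0 <= r by exact: le_trans (g0 k) (ltW kr).
  have := xW r (g k.+1) r0 rk gk.
  have := dW r (g k.+1) (le_trans (gs k) (ltW kr)) rk gk.
  rewrite {1}gS => /(_ _)/(le_lt_trans (ler_norm _)) => Wr.
  have /Wr : g k + h - r < del by lra.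
  by move=> *; lra.
Qed.

End crossing_count.

Section small_at_some_time.
Context {R : realType} {d : measure_display} {T : measurableType d}.
Notation mu := (@lebesgue_measure R).
Variable P : probability T R.

(** A bound on the time integral of the paths in [Om] gives one deterministic
    time at which, within [Om], the process reaches [lam] only with small
    probability. Riemann sums replace Fubini's theorem, since [X] need not be jointly measurable. *)
Lemma exists_time_crossing_prob_le (X : R -> T -> R) (Om : set T) (s u lam I : R) :
  (forall t, 0 <= t -> measurable_fun setT (X t)) ->
  (forall t w, 0 <= t -> 0 <= X t w) ->
  measurable Om -> 0 <= s -> s < u -> 0 < lam -> 0 < I ->
  {ae P, forall w, Om w -> exists b m,
    [/\ increments_le (X ^~ w) b m, {within `[0, +oo[, continuous m} &
    \int[mu]_(r in `[0, u]) X r w <= I]} ->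
  exists t, s <= t <= u /\
    (P (Om `&` [set w | (lam <= X t w)%R]) <= (4 * I / (lam * (u - s)))%:E)%E.
Proof.
move=> mX X0 mOm s0 su lam0 I0 X_ae.
have us0 : 0 < u - s by rewrite subr_gt0.
pose t_ N i := s + i.+1%:R * ((u - s) / N.+1%:R).
have t_ge N i : s <= t_ N i.
  by rewrite lerDl mulr_ge0// divr_ge0// ltW.
have t_le N i : (i < N.+1)%N -> t_ N i <= u.
  move=> iN; rewrite /t_ mulrCA -lerBrDl -[leRHS]mulr1 ler_wpM2l ?(ltW us0)//.
  by rewrite ler_pdivrMr// mul1r ler_nat.
pose G N i := Om `&` [set w | lam <= X (t_ N i) w].
have mG N i : measurable (G N i).
  apply: measurableI => //.
  have := mX (t_ N i) (le_trans s0 (t_ge N i)) measurableT `[lam, +oo[%classic.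
  rewrite setTI (_ : _ @^-1` _ = [set w | lam <= X (t_ N i) w]).
    by apply; exact: measurable_itv.
  by apply/seteqP; split => w /=; rewrite in_itv/= andbT.
(* [f N w] is the proportion of grid times at which [X] is at least [lam],
   counted as zero outside [Om]. *)
pose f N w : R := N.+1%:R^-1 * \sum_(i < N.+1) \1_(G N i) w.
pose q := 2 * I / (lam * (u - s)).
have q0 : 0 < q by rewrite divr_gt0 ?mulr_gt0.
have mf N : measurable_fun setT (f N).
  by apply: measurable_funM => //; apply: measurable_sum => i; exact: measurable_indic.
have f_itv N w : 0 <= f N w <= 1.
  have S0 : 0 <= \sum_(i < N.+1) \1_(G N i) w :> R by apply: sumr_ge0.
  rewrite /f mulr_ge0//= ler_pdivrMl// mulr1.
  apply: (@le_trans _ _ (\sum_(i < N.+1) 1)).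
    by apply: ler_sum => i _; rewrite indicE lern1 leq_b1.
  by rewrite sumr_const card_ord.
pose p N w := Num.max (f N w - q) 0.
have mp N : measurable_fun setT (p N).
  by apply: measurable_maxr => //; exact: measurable_funB.
have p_itv N w : 0 <= p N w <= 1.
  have /andP[f0 f1] := f_itv N w.
  by rewrite le_max lexx orbT/= ge_max ler01 andbT; lra.
have p_cvg : {ae P, forall w, [set: T] w ->
    (EFin \o p N) w @[N --> \oo] --> (cst 0%E : T -> \bar R) w}.
  move: X_ae; apply: filterS => w Xw _ /=; apply: cvg_near_cst.
  have [Omw|nOm] := pselect (Om w); last first.
    apply: nearW => N; congr EFin; apply/max_idPr.
    rewrite /f big1 ?mulr0 ?sub0r ?oppr_le0 ?(ltW q0)// => i _.
    by rewrite indicE memNset// => -[].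
  have [b [m [incr cm intX]]] := Xw Omw.
  have := crossing_count_le incr cm (fun t t0 => X0 t w t0) s0 su lam0.
  apply: filterS => N cN; congr EFin; apply/max_idPr; rewrite subr_le0 /f.
  have {}cN := le_trans cN intX.
  have <- : \sum_(i < N.+1) (lam <= X (t_ N i) w)%R%:R = \sum_(i < N.+1) \1_(G N i) w :> R.
    apply: eq_bigr => i _; rewrite indicE /G in_setI mem_set//=.
    by congr (_%:R); congr nat_of_bool; apply/idP/idP; rewrite inE.
  rewrite /q ler_pdivlMr ?mulr_gt0//; move: cN; rewrite /t_.
  move: (\sum_(i < _) _) => S cN.
  rewrite [leLHS](_ : _ = 2 * (lam / 2 * ((u - s) / N.+1%:R) * S)) ?ler_pM2l//.
  by move: (N.+1%:R^-1) => n; field.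
have i1 : P.-integrable setT (cst 1%E).
  exact: (finite_measure_integrable_cst P 1 measurableT).
have p_bnd : {ae P, forall w N, [set: T] w -> (`|(EFin \o p N) w| <= cst 1%E w)%E}.
  apply: aeW => w N _ /=; have /andP[p0 p1] := p_itv N w.
  by rewrite lee_fin ger0_norm.
have [_ _] := @dominated_convergence _ T R P setT measurableT
  (fun N => EFin \o p N) (cst 0%E) (cst 1%E)
  (fun N => (measurable_EFinP _ _).2 (mp N)) (measurable_cst _) p_cvg i1 p_bnd.
rewrite integral_cst// mul0e => /fine_cvgP[p_fin /cvgrPdist_lt/(_ q q0) p_small].
have [N [pN_fin pN]] : exists N,
    (\int[P]_w (EFin \o p N) w)%E \is a fin_num /\
    `|0 - fine (\int[P]_w (EFin \o p N) w)%E| < q.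
  have [N _ /(_ N (leqnn _)) hN] := filterI p_fin p_small.
  by exists N.
have int_p : (\int[P]_w (EFin \o p N) w < q%:E)%E.
  rewrite -(fineK pN_fin) lte_fin; apply: le_lt_trans pN.
  by rewrite sub0r normrN ler_norm.
have int_f : (\int[P]_w (f N w)%:E = (N.+1%:R^-1)%:E * \sum_(i < N.+1) P (G N i))%E.
  under eq_integral do rewrite /f EFinM -sumEFin.
  rewrite ge0_integralZl//; last 2 first.
  - by apply: emeasurable_sum => i; apply/measurable_EFinP.
  - by move=> w _; apply: sume_ge0 => i _; rewrite lee_fin.
  congr (_ * _)%E; rewrite ge0_integral_sum//.
  - by apply: eq_bigr => i _; rewrite integral_indic// setIT.
  - by move=> i; apply/measurable_EFinP.
have : (\int[P]_w (f N w)%:E < (2 * q)%:E)%E.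
  apply: (@le_lt_trans _ _ (\int[P]_w (q%:E + (EFin \o p N) w))%E).
    apply: ge0_le_integral => //.
    - by move=> w _; rewrite lee_fin; have /andP[] := f_itv N w.
    - exact/measurable_EFinP.
    - by apply: emeasurable_funD => //; exact/measurable_EFinP.
    - move=> w _ /=; rewrite -EFinD lee_fin -lerBlDl /p.
      by rewrite le_max lexx.
  rewrite ge0_integralD//; last 3 first.
  - by move=> w _; rewrite lee_fin ltW.
  - by move=> w _; rewrite lee_fin; have /andP[] := p_itv N w.
  - exact/measurable_EFinP.
  rewrite integral_cst// [X in (_ * X + _)%E](_ : _ = 1%E); last first.
    exact: probability_setT.
  rewrite mule1.
  by rewrite mulrDl mul1r EFinD lteD2lE.
rewrite int_f => int_lt.
apply: contrapT => /forallNP no_t.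
move: int_lt; apply/negP; rewrite -leNgt lee_pdivlMl// -EFinM.
have -> : (N.+1%:R * (2 * q))%:E = (\sum_(i < N.+1) (2 * q)%:E)%E.
  by rewrite sumEFin sumr_const card_ord mulr_natl.
apply: lee_sum => i _; have /not_andP[] := no_t (t_ N i).
  by rewrite t_ge t_le.
move=> /negP; rewrite -ltNge => /ltW.
by rewrite (_ : 4 * I / (lam * (u - s)) = 2 * q)// /q; field; rewrite !lt0r_neq0.
Qed.

End small_at_some_time.

(** * Exponents on a dyadic window *)

Section window.
Context {R : realType}.
Variables (alpha kappa beta K : R) (n : nat) (xi theta' gamma : 'I_n -> R).
Implicit Types (x y c m A : R -> R) (s t v T a eps r e q : R).

(** Drift of the process, with dissipation [y] and random constant [c]. *)
Definition drift y c x t : R :=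
  - y t + c t * (1 + t) `^ kappa * x t `^ alpha + c t * (1 + t) `^ (- beta).

(** Bound on the growth rate of the quadratic variation. *)
Definition variation_rate y x t : R :=
  K * \sum_(j < n) (1 + t) `^ (xi j) * x t `^ (gamma j * theta' j)
                   * y t `^ (1 - theta' j).

Lemma powRDT T e1 e2 : 0 < T -> T `^ (e1 + e2) = T `^ e1 * T `^ e2.
Proof. by move=> T0; rewrite powRD//; apply/implyP => _; exact: lt0r_neq0. Qed.

Lemma powR_window_le T t e : 1 <= T -> T <= t -> t <= 4 * T ->
  (1 + t) `^ e <= 5 `^ `|e| * T `^ e.
Proof.
move=> T1 Tt t4; have T0 : 0 < T by lra.
have [e0|e0] := leP 0 e.
  rewrite ger0_norm// -powRM ?(ltW T0)//; apply: ge0_ler_powR; rewrite ?nnegrE//; lra.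
have le_Te : (1 + t) `^ e <= T `^ e.
  rewrite -[e]opprK !(powRN _ (- e)) lef_pV2 ?posrE ?powR_gt0//; last lra.
  by apply: ge0_ler_powR; rewrite ?nnegrE; lra.
apply: (le_trans le_Te); rewrite ler_peMl ?powR_ge0//.
by rewrite -[leLHS](powRr0 5) ler_powR//; lra.
Qed.

Lemma powR_le1D v q : 0 <= v -> 0 <= q -> q <= 1 -> v `^ q <= 1 + v.
Proof.
move=> v0 q0 q1; have [v1|v1] := leP v 1.
  have : v `^ q <= 1 `^ q by apply: ge0_ler_powR; rewrite ?nnegrE.
  by rewrite powR1 => *; lra.
by have := ler1_powR (ltW v1) q1 => *; lra.
Qed.

Let Kc := `|K| * \sum_(j < n) 5 `^ `|xi j|.

Lemma drift_le x y c T a eps r t : 1 <= T -> 0 < alpha -> 0 <= r ->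
  eps <= a * (alpha - 1) - 1 - kappa -> eps <= beta - 1 - a ->
  T <= t -> t <= 4 * T -> 0 <= x t -> 0 <= c t -> c t <= r ->
  x t <= T `^ (- a) ->
  drift y c x t <=
    - y t + r * (5 `^ `|kappa| + 5 `^ `|beta|) * T `^ (- a - 1 - eps).
Proof.
move=> T1 al0 r0 e1 e2 Tt t4 x0 c0 cr xL; have T0 : 0 < T by lra.
rewrite /drift -addrA lerD2l mulrDr mulrDl; apply: lerD.
  rewrite -mulrA -[leRHS]mulrA ler_pM// ?mulr_ge0 ?powR_ge0//.
  apply: (@le_trans _ _ (5 `^ `|kappa| * T `^ kappa * T `^ (- a * alpha))).
    rewrite ler_pM ?powR_ge0//; first exact: powR_window_le.
    by rewrite powRrM; apply: ge0_ler_powR; rewrite ?nnegrE ?powR_ge0// ltW.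
  rewrite -mulrA -powRDT// ler_wpM2l ?powR_ge0// ler_powR//; lra.
rewrite -mulrA ler_pM// ?powR_ge0//.
apply: (@le_trans _ _ (5 `^ `|- beta| * T `^ (- beta))).
  exact: powR_window_le.
by rewrite normrN ler_wpM2l ?powR_ge0// ler_powR//; lra.
Qed.

(** At height [T `^ (- a)] each term of the rate is interpolated between a
    constant and a multiple of the dissipation [y t], with threshold
    [T `^ (- a - 1)]: the dissipation needed to use up the height [T `^ (- a)]
    during a time [T]. *)
Lemma variation_rate_le x y T a eps t : 1 <= T ->
  (forall j, 0 <= theta' j) -> (forall j, theta' j <= 1) ->
  (forall j, 0 < gamma j) ->
  (forall j, eps <= a * (gamma j * theta' j - theta' j - 1) - xi j - theta' j) ->
  T <= t -> t <= 4 * T -> 0 <= x t -> 0 <= y t -> x t <= T `^ (- a) ->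
  variation_rate y x t <=
    Kc * T `^ (- 1 - 2 * a - eps) + Kc * T `^ (- a - eps) * y t.
Proof.
move=> T1 th0 th1 ga0 heps Tt t4 x0 y0 xL; have T0 : 0 < T by lra.
have -> : Kc * T `^ (- 1 - 2 * a - eps) + Kc * T `^ (- a - eps) * y t =
    Kc * (T `^ (- 1 - 2 * a - eps) * (1 + T `^ (a + 1) * y t)).
  have -> : T `^ (- a - eps) = T `^ (- 1 - 2 * a - eps) * T `^ (a + 1).
    by rewrite -powRDT//; congr (_ `^ _); ring.
  by ring.
rewrite /variation_rate /Kc -mulrA.
have S0 : 0 <= \sum_(j < n) (1 + t) `^ (xi j) * x t `^ (gamma j * theta' j)
                   * y t `^ (1 - theta' j).
  by apply: sumr_ge0 => j _; rewrite !mulr_ge0 ?powR_ge0.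
apply: (le_trans (ler_wpM2r S0 (ler_norm K))); rewrite ler_wpM2l//.
rewrite mulr_suml; apply: ler_sum => j _.
have y_le : y t `^ (1 - theta' j) <=
    T `^ ((- a - 1) * (1 - theta' j)) * (1 + T `^ (a + 1) * y t).
  have -> : y t = T `^ (- a - 1) * (T `^ (a + 1) * y t).
    rewrite mulrA -powRDT// (_ : - a - 1 + (a + 1) = 0) ?powRr0 ?mul1r//; ring.
  rewrite powRM ?powR_ge0 ?mulr_ge0 ?powR_ge0// -powRrM ler_wpM2l ?powR_ge0//.
  rewrite [X in 1 + _ * X](_ : _ = y t); last first.
    rewrite mulrA -powRDT// (_ : - a - 1 + (a + 1) = 0) ?powRr0 ?mul1r//; ring.
  by apply: powR_le1D; rewrite ?mulr_ge0 ?powR_ge0//; have := th0 j; have := th1 j; lra.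
have x_le : x t `^ (gamma j * theta' j) <= T `^ (- a * (gamma j * theta' j)).
  rewrite [leRHS]powRrM; apply: ge0_ler_powR; rewrite ?nnegrE ?powR_ge0//.
  by rewrite mulr_ge0 ?th0// ltW.
apply: (@le_trans _ _ (5 `^ `|xi j| * T `^ (xi j) *
    T `^ (- a * (gamma j * theta' j)) *
    (T `^ ((- a - 1) * (1 - theta' j)) * (1 + T `^ (a + 1) * y t)))).
  rewrite ler_pM ?mulr_ge0 ?powR_ge0// ler_pM ?powR_ge0//.
  exact: powR_window_le.
rewrite -!mulrA ler_wpM2l ?powR_ge0// !mulrA -!powRDT//.
rewrite ler_wpM2r//; first by rewrite addr_ge0// mulr_ge0 ?powR_ge0.
rewrite ler_powR//; have := heps j; lra.
Qed.

(** On a window of length comparable with [T], a path that starts well below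
    [T `^ (- a)] and leaves this height does so through a noise increment of
    size [T `^ (- a)], while the quadratic variation is still at most of order
    [T `^ (- 2 * a - eps)]. *)
Lemma window_exit x y c m A T s a eps r :
  1 <= T -> 0 < alpha -> 0 <= r ->
  (forall j, 0 <= theta' j) -> (forall j, theta' j <= 1) ->
  (forall j, 0 < gamma j) ->
  eps <= a * (alpha - 1) - 1 - kappa -> eps <= beta - 1 - a ->
  (forall j, eps <= a * (gamma j * theta' j - theta' j - 1) - xi j - theta' j) ->
  4 * r * (5 `^ `|kappa| + 5 `^ `|beta|) * T `^ (- eps) <= 1 / 8 ->
  T <= s -> s <= 4 * T ->
  increments_le x (drift y c x) m ->
  increments_le A (variation_rate y x) (fun=> 0) ->
  {within `[0, +oo[, continuous m} ->
  (forall t, 0 <= t -> 0 <= x t) -> (forall t, 0 <= t -> 0 <= y t) ->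
  (forall t, 0 <= t -> 0 <= c t <= r) ->
  x s <= T `^ (- a) / 8 ->
  ~ (forall t, s <= t -> t <= 4 * T -> x t <= T `^ (- a)) ->
  exists v, [/\ s <= v, v <= 4 * T, T `^ (- a) / 8 <= `|m v - m s| &
    A v - A s <= 5 * Kc * T `^ (- 2 * a - eps)].
Proof.
move=> T1 al0 r0 th0 th1 ga0 e1 e2 e3 hT Ts s4 incr incrA cm x0 y0 c0 xs nx.
have T0 : 0 < T by lra.
have s0 : 0 <= s by lra.
pose L := T `^ (- a); have L0 : 0 < L by exact: powR_gt0.
pose D := r * (5 `^ `|kappa| + 5 `^ `|beta|) * T `^ (- a - 1 - eps).
have D0 : 0 <= D by rewrite !mulr_ge0 ?addr_ge0 ?powR_ge0.
have Kc0 : 0 <= Kc.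
  by rewrite mulr_ge0// sumr_ge0// => j _; exact: powR_ge0.
pose G := Kc * T `^ (- 1 - 2 * a - eps).
pose G' := Kc * T `^ (- a - eps).
have G0 : 0 <= G by rewrite mulr_ge0 ?powR_ge0.
have G'0 : 0 <= G' by rewrite mulr_ge0 ?powR_ge0.
have D4T : D * (4 * T) <= L / 8.
  have -> : D * (4 * T) =
      4 * r * (5 `^ `|kappa| + 5 `^ `|beta|) * T `^ (- eps) * L.
    have TE : T `^ (- a - 1 - eps) * T = T `^ (- eps) * L.
      rewrite -{2}(powRr1 (ltW T0)) -!powRDT//; congr (_ `^ _); ring.
    rewrite /D -[RHS]mulrA -TE; ring.
  by rewrite -[leRHS]mulrC -[8^-1]mul1r ler_wpM2r// ltW.
have DL : D * (4 * T - s) <= L / 8.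
  by apply: le_trans D4T; rewrite ler_wpM2l//; lra.
have [v [sv vu mv Av]] : exists v, [/\ s <= v, v <= 4 * T, L / 8 <= `|m v - m s| &
    A v - A s <= (G + G' * D) * (4 * T - s) + G' * (L / 4)].
  apply: (exit_small_quadratic_increment incr incrA cm x0 s0 s4 L0 D0 G0 G'0 _ DL xs nx).
  move=> t st t4 xL; have t0 : 0 <= t by lra.
  have Tt : T <= t by lra.
  have /andP[ct0 ctr] := c0 t t0.
  have dD := drift_le y T1 al0 r0 e1 e2 Tt t4 (x0 t t0) ct0 ctr xL.
  split; first by apply: (le_trans dD); rewrite gerDr oppr_le0 y0.
  have := variation_rate_le T1 th0 th1 ga0 e3 Tt t4 (x0 t t0) (y0 t t0) xL.
  move=> /le_trans; apply; rewrite lerD2l ler_wpM2l//.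
  by move: dD; rewrite -/D; lra.
exists v; split => //; apply: (le_trans Av).
have TG : G * (4 * T) = 4 * (Kc * T `^ (- 2 * a - eps)).
  have -> : T `^ (- 2 * a - eps) = T `^ (- 1 - 2 * a - eps) * T.
    rewrite -{3}(powRr1 (ltW T0)) -!powRDT//; congr (_ `^ _); ring.
  by rewrite /G; ring.
have LG : G' * L = Kc * T `^ (- 2 * a - eps).
  by rewrite /G' /L -mulrA -powRDT//; congr (_ * _ `^ _); ring.
have GE : (G + G' * D) * (4 * T - s) <= G * (4 * T) + G' * (L / 8).
  rewrite mulrDl -mulrA lerD// ler_wpM2l//; lra.
have V0 : 0 <= Kc * T `^ (- 2 * a - eps) by rewrite mulr_ge0 ?powR_ge0.
rewrite TG [G' * (L / 8)]mulrA LG in GE; rewrite [G' * (L / 4)]mulrA LG -[leRHS]mulrA.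
move: (Kc * _) V0 GE => V V0; move: ((G + G' * D) * _) => W; lra.
Qed.

End window.

(** * Choice of the exponent and almost sure statements *)

Section exponents.
Context {R : realType}.

Lemma affine_pos_left (k l x0 : R) :
  0 < x0 * k + l \/ 0 <= x0 * k + l /\ k < 0 ->
  \forall a \near x0^'-, 0 < a * k + l.
Proof.
case=> [pos|[nneg k0]].
  pose del := (x0 * k + l) / (`|k| + 1).
  have k1 : 0 < `|k| + 1 by rewrite ltr_wpDl.
  have del0 : 0 < del by rewrite divr_gt0.
  have : \forall a \near x0^'-, x0 - del < a by apply: nbhs_left_gt; lra.
  apply: filterS2 (nbhs_left_lt x0) => a a1 a2.
  have -> : a * k + l = (x0 * k + l) - (x0 - a) * k by ring.
  rewrite subr_gt0; apply: (@le_lt_trans _ _ ((x0 - a) * `|k|)).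
    by rewrite ler_wpM2l ?ler_norm//; lra.
  apply: (@lt_le_trans _ _ (del * (`|k| + 1))).
    apply: (@le_lt_trans _ _ (del * `|k|)); first by rewrite ler_wpM2r//; lra.
    by rewrite ltr_pM2l//; lra.
  by rewrite /del divfK// gt_eqF.
apply: filterS (nbhs_left_lt x0) => a ax.
have -> : a * k + l = (x0 * k + l) + (x0 - a) * - k by ring.
by rewrite ltr_wpDl// mulr_gt0; lra.
Qed.

Lemma exists_pos_lower_bound n (g : 'I_n -> R) : (forall j, 0 < g j) ->
  exists2 e, 0 < e & forall j, e <= g j.
Proof.
move=> g0; exists (\big[Num.min/1]_j g j); first exact: lt_bigmin.
by move=> j; exact: bigmin_le.
Qed.

Variables (n : nat) (p beta zeta theta : R) (xi theta' gamma : 'I_n -> R).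
Notation rho_bar := (rho_bar p beta zeta theta xi theta' gamma).

Lemma rho_bar_le :
  [/\ rho_bar <= 1 - p, rho_bar <= beta - 1,
      forall j, theta' j = 0 -> rho_bar <= - xi j &
      forall j, 0 < theta' j -> psi theta' gamma j < 0 ->
        rho_bar <= (theta' j + xi j) / (theta' j * psi theta' gamma j)].
Proof.
have E := rho_barE p beta zeta theta xi theta' gamma.
split=> [||j j0|j j0 psi0]; rewrite -lee_fin E /rho_bar_ereal.
- by rewrite ge_min lexx.
- rewrite ge_min ge_min; apply/orP; right; apply/orP; left.
  by rewrite lee_fin lerD2r ge_min lexx.
- rewrite !ge_min; apply/orP; right; apply/orP; right; apply/orP; left.
  rewrite EFinN leeN2 /xi_max; apply: (le_bigmax_cond _ (fun j => (xi j)%:E)).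
  exact/eqP.
- rewrite !ge_min; do 3 (apply/orP; right).
  apply: (bigmin_le_cond _ (fun j => ((theta' j + xi j) / (theta' j * psi theta' gamma j))%:E)).
  by rewrite j0 psi0.
Qed.

(** All the constraints on the decay exponent are affine; each holds strictly at
    [rho_bar], or weakly there and strictly just below. Hence some exponent [a]
    close to [rho_bar] satisfies all of them with a common margin [eps]. *)
Lemma exists_exponents (alpha kappa rho : R) :
  (forall j, 0 <= theta' j) ->
  (forall j, 0 < theta' j -> 0 <= psi theta' gamma j ->
    xi j < theta' j * (rho_bar * psi theta' gamma j - 1)) ->
  kappa < (alpha - 1) * rho_bar - 1 -> rho < rho_bar ->
  exists a eps, [/\ rho <= a, 0 < eps,
    eps <= a * (alpha - 1) - 1 - kappa /\ eps <= beta - 1 - a, eps <= 1 - p - a &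
    forall j, eps <= a * (gamma j * theta' j - theta' j - 1) - xi j - theta' j].
Proof.
move=> th0 A1 A2 rho_lt; have [rb1 rb2 rb3 rb4] := rho_bar_le.
have near_j : \forall a \near rho_bar^'-, forall j,
    0 < a * (gamma j * theta' j - theta' j - 1) + (- xi j - theta' j).
  apply: filter_forall => j; apply: affine_pos_left.
  have := th0 j; rewrite le_eqVlt => /predU1P[th|th].
    have := rb3 j (esym th); rewrite -th => h; right; split; lra.
  have -> : gamma j * theta' j - theta' j - 1 = theta' j * psi theta' gamma j.
    by rewrite /psi; field; rewrite gt_eqF.
  have [psi0|psi0] := leP 0 (psi theta' gamma j).
    by left; have := A1 j th psi0; rewrite mulrBr mulr1 mulrCA => *; lra.
  right; have thpsi : theta' j * psi theta' gamma j < 0 by rewrite pmulr_rlt0.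
  by split=> //; have := rb4 j th psi0; rewrite ler_ndivlMr// => *; lra.
have near1 : \forall a \near rho_bar^'-, 0 < a * (alpha - 1) + (- 1 - kappa).
  by apply: affine_pos_left; left; rewrite mulrC; lra.
have [a [[[aj a1] a2] a3]] := filter_ex (filterI (filterI (filterI near_j near1)
  (nbhs_left_gt rho_lt)) (nbhs_left_lt rho_bar)).
have [e e0 ej] := exists_pos_lower_bound aj.
exists a, (Num.min e (Num.min (a * (alpha - 1) + (- 1 - kappa)) (rho_bar - a))).
split; first exact: ltW.
- by rewrite !lt_min e0 a1 subr_gt0.
- by split; rewrite !ge_min; apply/orP; right; apply/orP; [left|right]; lra.
- by rewrite !ge_min; apply/orP; right; apply/orP; right; lra.
- by move=> j; rewrite ge_min; apply/orP; left; have := ej j; lra.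
Qed.

End exponents.

Section almost_surely.
Context {R : realType} {d : measure_display} {T : measurableType d}.
Variable P : probability T R.

Lemma geometric_Borel_Cantelli (B : nat -> set T) (c q : R) :
  (forall k, measurable (B k)) -> 0 <= c -> 0 < q -> q < 1 ->
  (forall k, (P (B k) <= (c * q ^+ k)%:E)%E) ->
  {ae P, forall w, exists N, forall k, (N <= k)%N -> ~ B k w}.
Proof.
move=> mB c0 q0 q1 PB.
have : P (lim_sup_set B) = 0%E.
  apply: lim_sup_set_cvg0 => //.
  apply: (@le_lt_trans _ _ (c / (1 - q))%:E); last exact: ltry.
  apply: lime_le; first by apply: is_cvg_nneseries => k _ _; exact: measure_ge0.
  apply: nearW => N; apply: (@le_trans _ _ (\sum_(0 <= k < N) (c * q ^+ k)%:E)%E).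
    by apply: lee_sum => k _; exact: PB.
  rewrite sumEFin lee_fin; apply: geometric_le_lim => //.
  by rewrite gtr0_norm.
move=> P0; exists (lim_sup_set B); split => //.
  by apply: bigcap_measurable => // k _; apply: bigcup_measurable.
move=> w /= nw N _; apply: contrapT => nB; apply: nw; exists N => k Nk Bk.
by apply: nB; exists k.
Qed.

Lemma nondecreasing_process_lim_gt (C : R -> T -> R) w (r : R) :
  nondecreasing_process C ->
  (r%:E < lim ((C t w)%:E @[t --> +oo_R]))%E <-> exists k : nat, r < C k%:R w.
Proof.
move=> C_nd; pose D t := (C (Num.max t 0) w)%:E.
have D_nd : {homo D : s t / s <= t >-> (s <= t)%E}.
  move=> s t st; rewrite lee_fin; apply: C_nd; first by rewrite le_max lexx orbT.
  by rewrite ge_max !le_max st lexx orbT.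
have D_cvg := nondecreasing_is_cvge D_nd.
have DC : lim ((C t w)%:E @[t --> +oo_R]) = lim (D t @[t --> +oo_R]).
  apply: cvg_lim => //; apply: cvg_trans D_cvg; apply: near_eq_cvg.
  have : \forall t \near +oo_R, 0 <= t by exact: nbhs_pinfty_ge.
  by apply: filterS => t t0; rewrite /D max_l.
rewrite DC; split=> [|[k rk]].
  move=> rD; apply: contrapT => /forallNP Cr; move: rD; apply/negP.
  rewrite -leNgt; apply: lime_le => //; apply: nearW => t; rewrite lee_fin.
  have tk : Num.max t 0 <= (Num.truncn (Num.max t 0)).+1%:R by exact/ltW/truncnS_gt.
  apply: le_trans (C_nd w _ _ _ tk) _; first by rewrite le_max lexx orbT.
  by have /negP := Cr (Num.truncn (Num.max t 0)).+1; rewrite -leNgt.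
apply: (@lt_le_trans _ _ (C k%:R w)%:E); first by rewrite lte_fin.
apply: lime_ge => //; have : \forall t \near +oo_R, k%:R <= t.
  by apply: nbhs_pinfty_ge; exact: num_real.
apply: filterS => t kt; rewrite lee_fin; apply: C_nd => //.
by rewrite le_max kt.
Qed.

(** If the tails of the limit of [C] vanish, then almost every path of [C]
    is bounded by some natural number. *)
Lemma ae_bounded_process (F : R -> set (set T)) (C : R -> T -> R) :
  filtration F -> adapted F C -> nondecreasing_process C ->
  P [set w | (r%:E < lim ((C t w)%:E @[t --> +oo_R]))%E] @[r --> +oo_R] --> 0%E ->
  {ae P, forall w, exists r : nat, forall t, 0 <= t -> C t w <= r.+1%:R}.
Proof.
move=> F_filt aC C_nd A3.
pose N r := [set w | (r%:E < lim ((C t w)%:E @[t --> +oo_R]))%E].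
have mN r : measurable (N r).
  rewrite (_ : N r = \bigcup_(k : nat) (C k%:R @^-1` `]r, +oo[)).
    apply: bigcupT_measurable => k; apply: (filtration_measurable F_filt (ler0n _ k)).
    by apply: aC => //; exact: measurable_itv.
  apply/seteqP; split => w /=.
    move=> /(nondecreasing_process_lim_gt _ _ C_nd)[k rk].
    by exists k => //=; rewrite in_itv/= rk.
  move=> [k _] /=; rewrite in_itv/= andbT => rk.
  by apply/(nondecreasing_process_lim_gt _ _ C_nd); exists k.
exists (\bigcap_(r : nat) N r.+1%:R); split.
- exact: bigcapT_measurable.
- apply/le_anti; rewrite measure_ge0 andbT.
  have A3n : P (N r.+1%:R) @[r --> \oo] --> 0%E.
    apply: (cvg_comp _ _ _ A3) => //.
    by rewrite cvg_shiftS; exact: cvgr_idn.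
  rewrite -(cvg_lim _ A3n)//; apply: lime_ge; first by apply/cvg_ex; exists 0%E.
  apply: nearW => r; apply: le_measure; rewrite ?inE//.
    exact: bigcapT_measurable.
  exact: bigcap_inf.
move=> w /= nw r _ /=; apply: contrapT => nN; apply: nw; exists r => t t0.
have tk : t <= (Num.truncn t).+1%:R by exact/ltW/truncnS_gt.
apply: (le_trans (C_nd w _ _ t0 tk)); rewrite leNgt; apply/negP => rC; apply: nN.
by apply/(nondecreasing_process_lim_gt _ _ C_nd); eexists; exact: rC.
Unshelve. all: by end_near. Qed.

End almost_surely.

(** * Decay along dyadic windows *)

Section decay.
Context {R : realType} {d : measure_display} {T : measurableType d}.
Notation mu := (@lebesgue_measure R).
Variables (P : probability T R) (F : R -> set (set T)).
Variables (X Y C M A : R -> T -> R) (alpha p kappa beta K : R).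
Variables (n : nat) (xi theta' gamma : 'I_n -> R).
Hypothesis F_filt : filtration F.
Hypotheses (X_adapted : adapted F X) (X_ge0 : forall t w, 0 <= t -> 0 <= X t w)
  (Y_ge0 : forall t w, 0 <= t -> 0 <= Y t w)
  (C_adapted : adapted F C) (C_gt0 : forall t w, 0 <= t -> 0 < C t w)
  (C_incr : nondecreasing_process C)
  (M_clm : continuous_local_martingale F P M)
  (A_qv : quadratic_variation F P M A)
  (alpha_gt0 : 0 < alpha) (p_ge0 : 0 <= p).
Hypothesis dX_le : {ae P, forall w, increments_le (X ^~ w)
  (drift alpha kappa beta (Y ^~ w) (C ^~ w) (X ^~ w)) (M ^~ w)}.
Hypothesis intX_le : {ae P, forall w, forall t : R, 0 <= t ->
  \int[mu]_(s in `[0, t]) X s w <= C t w * (1 + t) `^ p + C t w}.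
Hypotheses (theta'_ge0 : forall j, 0 <= theta' j)
  (theta'_le1 : forall j, theta' j <= 1) (gamma_gt0 : forall j, 0 < gamma j).
Hypothesis dA_le : {ae P, forall w, increments_le (A ^~ w)
  (variation_rate K xi theta' gamma (Y ^~ w) (X ^~ w)) (fun=> 0)}.
Variables (a eps r : R).
Hypotheses (eps_gt0 : 0 < eps) (r_gt0 : 0 < r)
  (eps_alpha : eps <= a * (alpha - 1) - 1 - kappa)
  (eps_beta : eps <= beta - 1 - a) (eps_p : eps <= 1 - p - a)
  (eps_xi : forall j,
     eps <= a * (gamma j * theta' j - theta' j - 1) - xi j - theta' j).

(** The event that the random constants stay below [r] forever. *)
Let bounded_paths : set T := [set w | forall t, 0 <= t -> C t w <= r].

Let measurable_bounded_paths : measurable bounded_paths.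
Proof.
rewrite (_ : bounded_paths = \bigcap_(k : nat) (C k%:R @^-1` `]-oo, r])).
  apply: bigcapT_measurable => k; apply: (filtration_measurable F_filt (ler0n _ k)).
  by apply: C_adapted => //; exact: measurable_itv.
apply/seteqP; split => w /=.
  by move=> Cr k _ /=; rewrite in_itv/= Cr.
move=> Cr t t0; have tk : t <= (Num.truncn t).+1%:R by exact/ltW/truncnS_gt.
apply: (le_trans (C_incr w t0 tk)).
by have := Cr (Num.truncn t).+1 Logic.I; rewrite /= in_itv.
Qed.

Let Kc := `|K| * \sum_(j < n) 5 `^ `|xi j|.

(* The two terms come from the starting time and from the maximal inequality. *)
Let cB : R := 64 * r * 3 `^ p + 2048 * (5 * Kc + 1).

(** On the time window from [2 * t0] to [4 * t0], the height [t0 `^ (- a)] is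
    exceeded only on an event whose probability is at most a constant times a
    negative power of [t0]: either [X] is not small at the deterministic
    starting time between [t0] and [2 * t0], or the noise moves abnormally
    afterwards. *)
Lemma window_exit_event (t0 : R) : 1 <= t0 ->
  4 * r * (5 `^ `|kappa| + 5 `^ `|beta|) * t0 `^ (- eps) <= 1 / 8 ->
  exists B : set T, [/\ measurable B, (P B <= (cB * t0 `^ (- eps))%:E)%E &
    {ae P, forall w, bounded_paths w -> ~ B w ->
       forall t, 2 * t0 <= t -> t <= 4 * t0 -> X t w <= t0 `^ (- a)}].
Proof.
move=> t1 small; have t00 : 0 < t0 by exact: lt_le_trans t1.
have Kc0 : 0 <= Kc.
  by rewrite mulr_ge0// sumr_ge0// => j _; exact: powR_ge0.
have lam0 : 0 < t0 `^ (- a) / 8 by rewrite divr_gt0 ?powR_gt0.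
have I0 : 0 < 2 * r * (3 * t0) `^ p by rewrite !mulr_gt0 ?powR_gt0 ?mulr_gt0.
have start_ae : {ae P, forall w, bounded_paths w -> exists b m,
    [/\ increments_le (X ^~ w) b m, {within `[0, +oo[, continuous m} &
    \int[mu]_(s in `[0, 2 * t0]) X s w <= 2 * r * (3 * t0) `^ p]}.
  move: dX_le intX_le; apply: filterS2 => w dXw intXw Cw.
  exists (drift alpha kappa beta (Y ^~ w) (C ^~ w) (X ^~ w)), (M ^~ w).
  split; [exact: dXw|exact: M_clm.2.1|].
  have t20 : 0 <= 2 * t0 by lra.
  apply: (le_trans (intXw _ t20)).
  have C0 := ltW (C_gt0 w t20); have Cr := Cw _ t20.
  have p1 : 1 <= (3 * t0) `^ p.
    by rewrite -[leLHS](powRr0 (3 * t0)) ler_powR//; lra.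
  have p2 : (1 + 2 * t0) `^ p <= (3 * t0) `^ p.
    by apply: ge0_ler_powR => //; rewrite ?nnegrE; lra.
  have -> : 2 * r * (3 * t0) `^ p = r * (3 * t0) `^ p + r * (3 * t0) `^ p by ring.
  apply: lerD; first by rewrite ler_pM ?powR_ge0.
  by rewrite (le_trans Cr)// ler_peMr// ltW.
have [s [/andP[s1 s2] Ps]] := exists_time_crossing_prob_le
  (fun t t0 => adapted_measurable F_filt t0 X_adapted) X_ge0
  measurable_bounded_paths (ltW t00) (ltac:(lra) : t0 < 2 * t0) lam0 I0 start_ae.
have s0 : 0 <= s by lra.
have s4 : s < 4 * t0 by lra.
have b0 : 0 < (5 * Kc + 1) * t0 `^ (- 2 * a - eps).
  by rewrite mulr_gt0 ?powR_gt0// ltr_wpDl// mulr_ge0.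
have [E [mE PE EP]] := local_martingale_maximal_inequality F_filt M_clm A_qv s0 s4 lam0 b0.
pose S := bounded_paths `&` [set w | t0 `^ (- a) / 8 <= X s w].
have mS : measurable S.
  apply: measurableI => //.
  rewrite (_ : [set _ | _] = X s @^-1` `[t0 `^ (- a) / 8, +oo[).
    apply: (filtration_measurable F_filt s0).
    by apply: X_adapted => //; exact: measurable_itv.
  by apply/seteqP; split => w /=; rewrite in_itv/= andbT.
exists (S `|` E); split; first exact: measurableU.
- apply: (@le_trans _ _ (P S + P E)%E); first exact: measureU2.
  apply: (le_trans (leeD Ps PE)); rewrite -EFinD lee_fin /cB [leRHS]mulrDl lerD//.
    have -> : 4 * (2 * r * (3 * t0) `^ p) / (t0 `^ (- a) / 8 * (2 * t0 - t0)) =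
        64 * r * 3 `^ p * t0 `^ (p + a - 1).
      rewrite powRM ?(ltW t00)// !powRDT// powRN powR_inv1 ?(ltW t00)//.
      by field; rewrite !gt_eqF// powR_gt0.
    rewrite ler_wpM2l ?mulr_ge0 ?powR_ge0 ?(ltW r_gt0)// ler_powR//.
    have := eps_p; lra.
  have -> : t0 `^ (- 2 * a - eps) = t0 `^ (- a) ^+ 2 * t0 `^ (- eps).
    by rewrite expr2 -!powRDT//; congr (_ `^ _); ring.
  rewrite le_eqVlt; apply/orP; left; apply/eqP; field.
  by rewrite gt_eqF// powR_gt0.
move: dX_le dA_le; apply: filterS2 => w dXw dAw Cw nSE t t2 t4.
have [nS nE] : ~ S w /\ ~ E w by apply/not_orP => SE; exact: nSE.
have Xs : X s w <= t0 `^ (- a) / 8.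
  by apply/ltW; rewrite ltNge; apply/negP => Xs; apply: nS; split.
suff : forall t, s <= t -> t <= 4 * t0 -> X t w <= t0 `^ (- a).
  by apply=> //; exact: le_trans t2.
apply: contrapT => nX.
have C0 q : 0 <= q -> 0 <= C q w <= r.
  by move=> q0; rewrite ltW ?C_gt0// Cw.
have [v [sv vu Mv Av]] := window_exit t1 alpha_gt0 (ltW r_gt0) theta'_ge0 theta'_le1
  gamma_gt0 eps_alpha eps_beta eps_xi small s1 (ltW s4) dXw dAw (@M_clm.2.1 w)
  (fun t t0 => X_ge0 w t0) (fun t t0 => Y_ge0 w t0) C0 Xs nX.
apply: nE; apply: (EP w v) => //; apply: (le_trans Av).
by rewrite ler_wpM2r ?powR_ge0// lerDl.
Qed.

Lemma bounded_paths_decay (rho : R) : rho <= a ->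
  {ae P, forall w, bounded_paths w -> exists2 k : R, 0 < k &
     \forall t \near +oo_R, X t w <= k * t `^ (- rho)}.
Proof.
move=> rho_a; pose q : R := 2 `^ (- eps).
have q0 : 0 < q by exact: powR_gt0.
have q1 : q < 1.
  rewrite /q powRN invf_lt1 ?powR_gt0//.
  have : 1 `^ eps < 2 `^ eps by apply: gt0_ltr_powR; rewrite ?nnegrE ?ltr1n.
  by rewrite powR1.
have powE k : (2 ^+ k) `^ (- eps) = q ^+ k :> R.
  by rewrite -powR_mulrn// powRAC powR_mulrn ?powR_ge0.
have [k0 small] : exists k0 : nat, forall k, (k0 <= k)%N ->
    4 * r * (5 `^ `|kappa| + 5 `^ `|beta|) * q ^+ k <= 1 / 8.
  have : geometric (4 * r * (5 `^ `|kappa| + 5 `^ `|beta|)) q k @[k --> \oo] --> 0.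
    by apply: cvg_geometric; rewrite gtr0_norm.
  move/cvgrPdist_le => /(_ (1 / 8) _)[|k0 _ hk]; first by rewrite divr_gt0.
  exists k0 => k kk; have := hk k kk; rewrite /= sub0r normrN.
  exact: le_trans (ler_norm _).
have window k : exists B : set T, [/\ measurable B,
    (P B <= (cB * q ^+ (k0 + k))%:E)%E &
    {ae P, forall w, bounded_paths w -> ~ B w ->
      forall t, 2 * 2 ^+ (k0 + k) <= t -> t <= 4 * 2 ^+ (k0 + k) ->
        X t w <= (2 ^+ (k0 + k)) `^ (- a)}].
  rewrite -powE; apply: window_exit_event; first by rewrite exprn_ege1// ler1n.
  by rewrite powE; apply: small; exact: leq_addr.
have [B BP] := choice window.
have cB0 : 0 <= cB.
  have Kc0 : 0 <= Kc.
    by apply: mulr_ge0 => //; apply: sumr_ge0 => j _; exact: powR_ge0.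
  apply: addr_ge0.
    by apply: mulr_ge0 (powR_ge0 _ _); exact: mulr_ge0 (ler0n _ _) (ltW r_gt0).
  apply: mulr_ge0 (ler0n _ _) _.
  exact: addr_ge0 (mulr_ge0 (ler0n _ _) Kc0) ler01.
have cq0 : 0 <= cB * q ^+ k0 by rewrite mulr_ge0// exprn_ge0// ltW.
have mB k : measurable (B k) by have [] := BP k.
have PB k : (P (B k) <= (cB * q ^+ k0 * q ^+ k)%:E)%E.
  by rewrite -mulrA -exprD; have [] := BP k.
have B_ae : {ae P, forall w, forall k, bounded_paths w -> ~ B k w ->
    forall t, 2 * 2 ^+ (k0 + k) <= t -> t <= 4 * 2 ^+ (k0 + k) ->
      X t w <= (2 ^+ (k0 + k)) `^ (- a)}.
  by apply: ae_foralln => k; have [] := BP k.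
move: (geometric_Borel_Cantelli mB cq0 q0 q1 PB) B_ae; apply: filterS2 => w [N nB] Bw Cw.
exists (4 `^ `|rho|); first exact: powR_gt0.
near=> t.
(* The time [t] lies in the window of index [k], starting at [2 ^+ (k0 + k)]. *)
have t_ge : 2 ^+ (k0 + N).+1 <= t by near: t; exact: nbhs_pinfty_ge.
have t0 : 0 < t by apply: lt_le_trans t_ge; rewrite exprn_gt0.
have tn0 : (0 < Num.truncn t)%N.
  by rewrite truncn_gt0; apply: le_trans t_ge; rewrite exprn_ege1// ler1n.
have /andP[kt tk] := trunc_log_bounds (isT : (1 < 2)%N) tn0.
set l := trunc_log 2 (Num.truncn t) in kt tk.
have Nl : ((k0 + N).+1 <= l)%N.
  apply: trunc_log_max => //; rewrite truncn_ge_nat ?(ltW t0)//.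
pose k := (l.-1 - k0)%N.
have l0 : (0 < l)%N by exact: leq_ltn_trans Nl.
have k0l : (k0 <= l.-1)%N by rewrite -ltnS prednK// (leq_ltn_trans (leq_addr N k0)).
have lk : l = (k0 + k).+1 by rewrite /k subnKC// prednK.
have Nk : (N <= k)%N by move: Nl; rewrite lk ltnS leq_add2l.
have /andP[tr1 tr2] := truncn_itv (ltW t0).
have lo : 2 * 2 ^+ (k0 + k) <= t.
  by rewrite -exprS -lk (le_trans _ tr1)// -natrX ler_nat.
have hi : t <= 4 * 2 ^+ (k0 + k).
  rewrite (le_trans (ltW tr2))// (_ : 4 = 2 * 2 :> R); last by rewrite -natrM.
  by rewrite -mulrA -!exprS -lk -natrX ler_nat.
apply: (le_trans (Bw k Cw (nB k Nk) t lo hi)).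
set s := 2 ^+ (k0 + k) in lo hi *.
have s1 : 1 <= s by rewrite exprn_ege1// ler1n.
apply: (@le_trans _ _ (s `^ (- rho))).
  by rewrite ler_powR// lerN2.
have s0 : 0 < s by exact: lt_le_trans s1.
have [rho0|rho0] := leP 0 rho.
  rewrite !powRN ger0_norm// -[X in _ <= X * _]invrK -invfM lef_pV2 ?posrE ?divr_gt0 ?mulr_gt0
    ?invr_gt0 ?powR_gt0//.
  rewrite mulrC ler_pdivrMr ?powR_gt0// -powRM ?(ltW s0)//.
  by apply: ge0_ler_powR; rewrite ?nnegrE// mulrC; lra.
apply: (@le_trans _ _ (t `^ (- rho))).
  by apply: ge0_ler_powR; rewrite ?nnegrE; lra.
rewrite ler_peMl ?powR_ge0// -[leLHS](powRr0 4) ler_powR//; lra.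
Unshelve. all: by end_near. Qed.

End decay.

Theorem lemma2p5 (R : realType) (d : measure_display) (T : measurableType d)
    (P : probability T R) (F : R -> set (set T))
    (X Y C M A : R -> T -> R) (alpha p kappa beta zeta theta K : R)
    (n : nat) (xi theta' gamma : 'I_n -> R)
    (F_filt : filtration F)
    (X_adapted : adapted F X) (X_ge0 : forall (t : R) (w : T), 0 <= t -> 0 <= X t w)
    (Y_adapted : adapted F Y) (Y_ge0 : forall (t : R) (w : T), 0 <= t -> 0 <= Y t w)
    (C_adapted : adapted F C) (C_gt0 : forall (t : R) (w : T), 0 <= t -> 0 < C t w)
    (C_incr : nondecreasing_process C)
    (M_clm : continuous_local_martingale F P M)
    (A_qv : quadratic_variation F P M A)
    (alpha_gt1 : 1 < alpha) (p_ge0 : 0 <= p)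
    (dX_le : {ae P, forall w, increments_le (fun t => X t w)
       (fun t => - Y t w + C t w * (1 + t) `^ kappa * X t w `^ alpha
                 + C t w * (1 + t) `^ (- beta))
       (fun t => M t w)})
    (intX_le : {ae P, forall w, forall t : R, 0 <= t ->
       \int[lebesgue_measure]_(s in `[0, t]) X s w
         <= C t w * (1 + t) `^ p + C t w})
    (theta_gt0 : 0 < theta) (theta_lt1 : theta < 1)
    (X_le_Y : {ae P, forall w, forall t : R, 0 <= t ->
       X t w <= C t w `^ theta * (1 + t) `^ (zeta * theta)
                * Y t w `^ (1 - theta)})
    (theta'_ge0 : forall j, 0 <= theta' j)
    (theta'_le1 : forall j, theta' j <= 1)
    (gamma_gt0 : forall j, 0 < gamma j)
    (dA_le : {ae P, forall w, increments_le (fun t => A t w)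
       (fun t => K * \sum_(j < n) (1 + t) `^ (xi j)
                   * X t w `^ (gamma j * theta' j)
                   * Y t w `^ (1 - theta' j))
       (fun=> 0)})
    (A1 : forall j, 0 < theta' j -> 0 <= psi theta' gamma j ->
       xi j < theta' j *
         (rho_bar p beta zeta theta xi theta' gamma * psi theta' gamma j - 1))
    (A2 : kappa <
       (alpha - 1) * rho_bar p beta zeta theta xi theta' gamma - 1)
    (A3 : P [set w | (r%:E < lim ((C t w)%:E @[t --> +oo_R]))%E] @[r --> +oo_R]
            --> 0%E)
    (rho : R) (rho_lt : rho < rho_bar p beta zeta theta xi theta' gamma) :
  {ae P, forall w,
     (fun t : R => X t w : R^o) =O_ (pinfty_nbhs R) (fun t : R => t `^ (- rho) : R^o)}.
Proof.
have alpha_gt0 : 0 < alpha by exact: lt_trans alpha_gt1.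
have [a [eps [rho_a eps_gt0 [eps_alpha eps_beta] eps_p eps_xi]]] :=
  exists_exponents theta'_ge0 A1 A2 rho_lt.
have decay (r : nat) := bounded_paths_decay F_filt X_adapted X_ge0 Y_ge0
  C_adapted C_gt0 C_incr M_clm A_qv alpha_gt0 p_ge0 dX_le intX_le
  theta'_ge0 theta'_le1 gamma_gt0 dA_le eps_gt0 (ltr0Sn R r) eps_alpha eps_beta
  eps_p eps_xi rho_a.
move: (ae_foralln decay) (ae_bounded_process F_filt C_adapted C_incr A3).
apply: filterS2 => w Xw [r Cr]; apply/eqO_exP.
have [k k0 Xk] := Xw r Cr; exists k => //.
have : \forall t \near +oo_R, 0 <= t by exact: nbhs_pinfty_ge.
move: Xk; apply: filterS2 => t Xt t0 /=.
by rewrite ger0_norm ?X_ge0// [leRHS]mulrC ger0_norm ?powR_ge0// mulrC.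
Qed.
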